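(* Assume the following. (Step sizes) $(\gamma_n)_{n\ge 0}$ is non-increasing, $\sum_{n\ge 0}\gamma_n=+\infty$ and $\lim_{n\to\infty}\gamma_n\ln(n)=0$. (H1) $K$ is Feller. (H2) The cemetery point is accessible: $\sum_{n\ge1}\overline{K}^n(x,\{\partial\})>0$ for all $x\in\mathcal{E}$. (H3) There exists a non-empty open set $U\subset\mathcal{E}$ which is accessible, i.e. $\sum_{n\ge1}K^n(x,U)>0$ for all $x\in\mathcal{E}$, and which is a weak small set, i.e. there are a probability measure $\Psi$ on $\mathcal{E}$ and $\epsilon>0$ such that $\sum_{n\ge1}K^n(x,A)\ge\epsilon\Psi(A)$ for all $x\in U$ and all Borel $A\subset\mathcal{E}$. (H4) There exists a non-increasing convex function $C:\mathbb{R}^+\to\mathbb{R}^+$ with $\int_0^\infty C(s)\,ds=\infty$ such that, for the measure $\Psi$ of (H3), $\dfrac{\Psi(K^n\mathbf{1})}{\sup_{x\in\mathcal{E}}K^n\mathbf{1}(x)}\ge C(n)$ for all $n$. Let $\mu^\star$ be the unique quasi-stationary distribution of $K$. Then, for any starting distribution $\alpha\in\mathcal{P}(\mathcal{E})$ (the law of $X_0$), the process $(X_n)_{n\ge0}$ converges in distribution to $\mu^\star$.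
   Context: $\mathcal{E}$ is a compact metric space with Borel $\sigma$-field $\mathcal{B}(\mathcal{E})$; $\mathcal{P}(\mathcal{E})$ is the set of Borel probability measures on $\mathcal{E}$ with the topology of weak convergence; $\mathbf{1}$ is the constant function $1$; $\mu(f)=\int f\,d\mu$. A sub-Markovian kernel on $\mathcal{E}$ is a map $Q:\mathcal{E}\times\mathcal{B}(\mathcal{E})\to[0,1]$ such that each $Q(x,\cdot)$ is a measure with $Q(x,\mathcal{E})>0$, and each $x\mapsto Q(x,A)$ is measurable; it is Markov if $Q(x,\mathcal{E})=1$ for all $x$. Write $Qf(x)=\int f(y)Q(x,dy)$, $\mu Q(\cdot)=\int\mu(dx)Q(x,\cdot)$, and $Q^n$ for the iterates ($Q^0(x,\cdot)=\delta_x$). $Q$ is Feller if $Qf$ is continuous whenever $f$ is continuous. A quasi-stationary distribution (QSD) for $Q$ is $\mu\in\mathcal{P}(\mathcal{E})$ with $\mu=\mu Q/(\mu Q\mathbf{1})$. Under the hypotheses of the claim, $K$ has a unique QSD. $K$ is a sub-Markovian kernel on $\mathcal{E}$, $\partial\notin\mathcal{E}$ is a cemetery point, and $\overline{K}$ is the Markov kernel on $\mathcal{E}\cup\{\partial\}$ with $\overline{K}(x,A)=K(x,A)$ and $\overline{K}(x,\{\partial\})=1-K(x,\mathcal{E})$ for $x\in\mathcal{E}$, $A\in\mathcal{B}(\mathcal{E})$, and $\overline{K}(\partial,\{\partial\})=1$. Let $\delta(x)=1-K(x,\mathcal{E})$ and, for $\mu\in\mathcal{P}(\mathcal{E})$,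 $K_\mu(x,A)=K(x,A)+\delta(x)\mu(A)$. $(\eta_n)_{n\ge0}$ is a sequence of positive numbers and $\gamma_n=\eta_n/\sum_{k=0}^n\eta_k$. On a filtered probability space $(\Omega,\mathcal{F},(\mathcal{F}_n)_{n\ge0},\mathbb{P})$, $(X_n)_{n\ge0}$ is an adapted $\mathcal{E}$-valued process, with $X_0$ of law $\alpha$, such that $\mathbb{P}(X_{n+1}\in dy\mid\mathcal{F}_n)=K_{\mu_n}(X_n,dy)$ for all $n\ge 0$, where $\mu_n=\dfrac{\sum_{k=0}^n\eta_k\delta_{X_k}}{\sum_{k=0}^n\eta_k}$ (here $\delta_{X_k}$ is the Dirac mass at $X_k$). *)

(* Defs.v *)
From HB Require Import structures.
From mathcomp Require Import all_boot all_order all_algebra.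
From mathcomp Require Import all_classical all_reals all_analysis.
From mathcomp Require Import measurable_realfun.
Import Order.TTheory GRing.Theory Num.Theory.
Import numFieldNormedType.Exports.

Set Implicit Arguments.
Unset Strict Implicit.
Unset Printing Implicit Defensive.

Local Open Scope classical_set_scope.
Local Open Scope ring_scope.
Local Open Scope ereal_scope.

(* The point is there only because the library's measurable types are pointed;
   in the intended use the space carries a probability measure, so it is
   nonempty anyway. *)
#[short(type="pmetricType")]
HB.structure Definition PointedMetric (R : numDomainType) :=
  {T of Pointed T & Metric R T}.

Notation borel E := (g_sigma_algebraType (@open E)).

(* The adjunction of a cemetery point: [None] is the cemetery, and a set is
   measurable iff its trace on [T] is. *)
Definition option_display : measure_display -> measure_display.
Proof. exact. Qed.

Section option_measurable.
Context d (T : measurableType d).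

Definition option_measurable : set (set (option T)) :=
  [set A | measurable (Some @^-1` A)].

Let option_measurable0 : option_measurable set0.
Proof. by rewrite /option_measurable/= preimage_set0. Qed.

Let option_measurableC A : option_measurable A -> option_measurable (~` A).
Proof. by rewrite /option_measurable/= preimage_setC; exact: measurableC. Qed.

Let option_measurableU (F : (set (option T))^nat) :
  (forall i, option_measurable (F i)) -> option_measurable (\bigcup_i F i).
Proof.
move=> mF; rewrite /option_measurable/= preimage_bigcup.
by apply: bigcup_measurable => i _; exact: mF.
Qed.

HB.instance Definition _ := @isMeasurable.Build (option_display d)
  (option T) option_measurable option_measurable0 option_measurableC
  option_measurableU.

End option_measurable.

Section kernels.
Context d (T : measurableType d) (R : realType).

Definition submarkovian (K : R.-spker T ~> T) := forall x, 0 < K x setT.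

Definition kid : T -> {measure set T -> \bar R} :=
  kdirac (@measurable_id d T setT).

HB.instance Definition _ := ProbabilityKernel.on kid.

Fixpoint kiter (K : R.-spker T ~> T) (n : nat) : R.-spker T ~> T :=
  if n is m.+1 then mkcomp_noparam (kiter K m) K else kid.

Definition kill (K : R.-spker T ~> T) (x : T) : \bar R := 1 - K x setT.

(* A particle killed at [x] is relocated according to [mu]. *)
Definition kreturn (K : R.-spker T ~> T) (mu : set T -> \bar R)
  (x : T) (A : set T) : \bar R := K x A + kill K x * mu A.

Definition is_qsd (K : R.-spker T ~> T) (mu : probability T R) :=
  forall A, measurable A ->
    mu A = (\int[mu]_x K x A) / (\int[mu]_x K x setT).

End kernels.

Section cemetery_extension.
Context d (T : measurableType d) (R : realType) (K : R.-spker T ~> T).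

Lemma kill_ge0 x : 0 <= kill K x.
Proof. by rewrite /kill sube_ge0 ?sprob_kernel_le1 ?orbT. Qed.

(* The Markov extension of [K] with absorbing cemetery [None]. *)
Definition kbar_fun (x : option T) (A : set (option T)) : \bar R :=
  if x is Some y then K y (Some @^-1` A) + kill K y * \d_None A
  else \d_None A.

Section kbar_measure.
Variable x : option T.

Let kbar0 : kbar_fun x set0 = 0.
Proof.
by case: x => [y|]/=; rewrite ?preimage_set0 ?measure0 ?mule0 ?adde0.
Qed.

Let kbar_ge0 A : 0 <= kbar_fun x A.
Proof.
by case: x => [y|]//=; apply: adde_ge0 => //; apply: mule_ge0 => //;
  exact: kill_ge0.
Qed.

Let kbar_sigma_additive : semi_sigma_additive (kbar_fun x).
Proof.
case: x => [y|] F mF tF mUF; last exact: measure_semi_sigma_additive.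
rewrite /kbar_fun [X in X @ _ --> _](_ : _ = fun n =>
  \sum_(0 <= i < n) K y (Some @^-1` F i) +
  kill K y * \sum_(0 <= i < n) (\d_None (F i) : \bar R)); last first.
  apply/funext => n; rewrite big_split/= ge0_sume_distrr//.
have kF : kill K y \is a fin_num.
  rewrite ge0_fin_numE ?kill_ge0// (@le_lt_trans _ _ 1) ?ltry//.
  by rewrite /kill geeDl// oppe_le0.
apply: cvgeD.
- by apply: ge0_adde_def; rewrite inE ?mule_ge0 ?kill_ge0.
- rewrite preimage_bigcup; apply: measure_semi_sigma_additive => //.
  apply/trivIsetP => /= i j _ _ ij; rewrite -preimage_setI.
  by move/trivIsetP : tF => /(_ _ _ Logic.I Logic.I ij) ->.
- by apply: cvgeZl => //; exact: measure_semi_sigma_additive.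
Qed.

HB.instance Definition _ := isMeasure.Build _ _ _ (kbar_fun x)
  kbar0 kbar_ge0 kbar_sigma_additive.

End kbar_measure.

Definition kbar (x : option T) : {measure set (option T) -> \bar R} :=
  kbar_fun x.

Let measurable_kbar U : measurable U -> measurable_fun [set: _] (kbar ^~ U).
Proof.
move=> mU _ B mB; rewrite setTI; change (measurable
  ((fun y => K y (Some @^-1` U) + kill K y * \d_None U) @^-1` B)).
rewrite -[X in measurable X]setTI.
suff: measurable_fun [set: T]
  (fun y => K y (Some @^-1` U) + kill K y * \d_None U) by exact.
apply: emeasurable_funD; first exact: measurable_kernel.
apply: emeasurable_funM => //.
by apply: emeasurable_funB => //; exact: measurable_kernel.
Qed.

HB.instance Definition _ := isKernel.Build _ _ _ _ _ kbar measurable_kbar.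

Let kbar_prob x : kbar x setT = 1.
Proof.
case: x => [y|]; rewrite /kbar/= ?diracT// preimage_setT mule1 /kill.
by rewrite addeC subeK// ge0_fin_numE// (le_lt_trans (sprob_kernel_le1 _ _)) ?ltry.
Qed.

HB.instance Definition _ := Kernel_isProbability.Build _ _ _ _ _
  kbar kbar_prob.

End cemetery_extension.

Section metric_space.
Context (R : realType) (E : pmetricType R).

(* [Rintegral] is 0 on non-integrable functions; this does not interfere when
   [E] is compact, as continuous functions are then bounded. *)
Definition feller (K : R.-spker (borel E) ~> (borel E)) :=
  forall f : E -> R, continuous f ->
    continuous (fun x : E => \int[K x]_y f y)%R.

Definition accessible (K : R.-spker (borel E) ~> (borel E)) (U : set E) :=
  forall x, 0 < \sum_(1 <= n <oo) kiter K n x U.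

Definition cemetery_accessible (K : R.-spker (borel E) ~> (borel E)) :=
  forall x, 0 < \sum_(1 <= n <oo) kiter (kbar K) n (Some x) [set None].

Definition weak_small (K : R.-spker (borel E) ~> (borel E)) (U : set E)
    (Psi : probability (borel E) R) (eps : R) :=
  forall x, U x -> forall A : set (borel E), measurable A ->
    eps%:E * Psi A <= \sum_(1 <= n <oo) kiter K n x A.

Definition weak_cvg (mu : nat -> probability (borel E) R)
    (nu : probability (borel E) R) :=
  forall f : E -> R, continuous f -> [bounded f x | x in [set: E]] ->
    (\int[mu n]_x f x)%R @[n --> \oo] --> (\int[nu]_x f x)%R.

End metric_space.

Section step_sizes.
Context (R : realType) (eta : nat -> R).

Definition gamma (n : nat) : R := (eta n / \sum_(k < n.+1) eta k)%R.

(* The weighted occupation measure of [x 0, ..., x n], as a set function. *)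
Definition occupation d (T : measurableType d) (x : nat -> T) (n : nat)
    (A : set T) : \bar R :=
  (\sum_(k < n.+1) (eta k)%:E * \d_(x k) A) / (\sum_(k < n.+1) (eta k)%:E).

End step_sizes.

Section conditioning.
Context d (Omega : measurableType d).

Definition filtration (F : nat -> set (set Omega)) :=
  [/\ forall n, sigma_algebra setT (F n),
      forall n, F n `<=` measurable &
      forall m n, (m <= n)%N -> F m `<=` F n].

Definition adapted d' (T : measurableType d') (F : nat -> set (set Omega))
    (X : nat -> Omega -> T) :=
  forall n (A : set T), measurable A -> F n (X n @^-1` A).

(* [Y] is a version of the conditional probability of [A] given [G]. *)
Definition cond_prob (R : realType) (P : probability Omega R)
    (G : set (set Omega)) (A : set Omega) (Y : Omega -> \bar R) :=
  measurable_fun [set: g_sigma_algebraType G] (Y : g_sigma_algebraType G -> _)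
  /\ forall B, G B -> \int[P]_(w in B) Y w = P (A `&` B).

End conditioning.

(* Main.v *)
(* Let A = sum_n K^n, so that h = A f solves f = h - K h. Since the kernel with
   return at mu_n sends h to K h + delta mu_n(h), summing this identity along the
   path gives
     S_n mu_n(f) = sum_{k <= n} eta_k delta(X_k) mu_k(A f) + o(S_n) in L^1,
   S_n = eta_0 + ... + eta_n, the error being an Abel sum plus a martingale. As
   0 <= delta <= 1, |mu_n(f)| <= mu_n(phi) + o(1) follows from the same property
   of A f and A phi. Hence if |A^N g| <= e A^N 1 pointwise for some N, then N such
   steps give limsup E |mu_n(g)| <= e.

   For mu*(g) = 0 such an N exists for every e: the ratios A^N g / A^N 1
   oscillate less and less, because A^2 >= c Psi and
   Psi(A^N 1) / sup A^N 1 >= C(L N) / 2 has a divergent sum over even N. The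
   latter holds because at least half of A^N 1 comes from the terms K^n 1 with
   n <= L N.

   Finally K and K_{mu*} coincide on {g : mu*(g) = 0}, a space preserved by K, so
   E g(X_{n+m}) = E K^m g(X_n) + o(1) as n tends to infinity, while K^m g tends to
   0 uniformly. *)

Require Import Defs.
From HB Require Import structures.
From mathcomp Require Import all_boot all_order all_algebra.
From mathcomp Require Import all_classical all_reals all_analysis.
From mathcomp Require Import measurable_realfun.
From mathcomp Require Import ring lra.
Import Order.TTheory GRing.Theory Num.Theory.
Import numFieldNormedType.Exports.

Set Implicit Arguments.
Unset Strict Implicit.
Unset Printing Implicit Defensive.

Local Open Scope classical_set_scope.
Local Open Scope ring_scope.

(** * Positive functionals and operators on bounded measurable functions *)

(** [K] may be periodic: the small set condition bounds only the sum of its powers, so ratios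
    [K^n g / K^n 1] need not settle. The potential contains the identity and all powers at once, and
    it is the operator that the Poisson equation puts in front of the occupation measure. The price
    is that a survival ratio assumed for the powers of [K] has to be transferred to the powers of
    the potential. The contraction factors may tend to 1, so there is no rate; only the divergence
    of the sum of the gaps drives the oscillation to 0. Accordingly [N] is fixed by [e] before [n]
    tends to infinity. Convergence in law concerns expectations only, so [L^1] control of [mu_n(g)]
    is enough and no almost sure limit of [mu_n] is sought. Compactness and the Feller property make
    two pointwise facts uniform: the geometric decay of [K^n 1] and the minorization of the squared
    potential. Measures and kernels are handled as positive functionals on bounded measurable
    functions, so that an identity known on measurable sets extends to functions by one lemma. *)

Definition bm d (T : measurableType d) (R : realType) (f : T -> R) :=
  measurable_fun [set: T] f /\ exists c : R, forall x, `|f x| <= c.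

Section bounded_measurable.
Context d (T : measurableType d) (R : realType).
Implicit Types f g : T -> R.

Lemma bm_ub f : bm f -> exists2 c : R, 0 <= c & forall x, `|f x| <= c.
Proof.
case=> _ [c fc]; exists (Num.max c 0); first by rewrite le_max lexx orbT.
by move=> x; rewrite le_max fc.
Qed.

Lemma bm_cst (c : R) : bm (fun _ : T => c).
Proof. by split=> //; exists `|c|. Qed.

Lemma bmD f g : bm f -> bm g -> bm (fun x => f x + g x).
Proof.
move=> [mf [c fc]] [mg [e ge]]; split; first exact: measurable_funD.
by exists (c + e) => x; rewrite (le_trans (ler_normD _ _))// lerD.
Qed.

Lemma bmN f : bm f -> bm (fun x => - f x).
Proof.
move=> [mf [c fc]]; split; first exact: measurableT_comp.
by exists c => x; rewrite normrN.
Qed.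

Lemma bmB f g : bm f -> bm g -> bm (fun x => f x - g x).
Proof. by move=> bf bg; apply: bmD => //; exact: bmN. Qed.

Lemma bmM f g : bm f -> bm g -> bm (fun x => f x * g x).
Proof.
move=> [mf [c fc]] [mg [e ge]]; split; first exact: measurable_funM.
by exists (c * e) => x; rewrite normrM ler_pM.
Qed.

Lemma bmZ (a : R) f : bm f -> bm (fun x => a * f x).
Proof. by move=> bf; apply: bmM => //; exact: bm_cst. Qed.

Lemma bm_sum I (r : seq I) (P : pred I) (F : I -> T -> R) :
  (forall i, bm (F i)) -> bm (fun x => \sum_(i <- r | P i) F i x).
Proof.
move=> bF; elim: r => [|i r IH].
  by under [X in bm X]eq_fun do rewrite big_nil; exact: bm_cst.
under [X in bm X]eq_fun do rewrite big_cons.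
by case: (P i) => //; exact: bmD.
Qed.

Lemma bm_norm f : bm f -> bm (fun x => `|f x|).
Proof.
move=> [mf [c fc]]; split; first exact: measurableT_comp.
by exists c => x; rewrite normr_id.
Qed.

Lemma bm_max0 f : bm f -> bm (fun x => Num.max 0 (f x)).
Proof.
move=> [mf [c fc]]; split; first exact: measurable_maxr.
exists c => x; have := fc x; rewrite maxEle; case: ifP => // _.
by rewrite normr0; exact: le_trans.
Qed.

Lemma bm_indic (A : set T) : measurable A -> bm (\1_A : T -> R).
Proof.
move=> mA; split; first exact: measurable_indic.
by exists 1 => x; rewrite indicE; case: (_ \in _); rewrite ?normr1 ?normr0.
Qed.

Lemma bm_comp d' (T' : measurableType d') (u : T' -> T) f :
  measurable_fun setT u -> bm f -> bm (fun x => f (u x)).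
Proof.
move=> mu [mf [c fc]]; split; first exact: (measurableT_comp mf).
by exists c => x; exact: fc.
Qed.

Lemma bm_lim (F : nat -> T -> R) f (c : R) : (forall n, bm (F n)) ->
  (forall x, `|f x| <= c) ->
  (forall x, (F n x) @[n --> \oo] --> f x) -> bm f.
Proof.
move=> bF fc Ff; split; last by exists c.
apply: (@measurable_fun_cvg _ _ _ setT (fun n => F n)) => //.
by move=> n; case: (bF n).
Qed.

(* Bounded linear functionals on bounded measurable functions; [L] is
   unconstrained elsewhere. *)
Definition blf (L : (T -> R) -> R) :=
  (forall (a : R) f g, bm f -> bm g ->
     L (fun x => a * f x + g x) = a * L f + L g) /\
  exists C : R, forall f (c : R), bm f -> (forall x, `|f x| <= c) ->
    `|L f| <= C * c.

Definition plf (L : (T -> R) -> R) :=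
  (forall (a : R) f g, bm f -> bm g ->
     L (fun x => a * f x + g x) = a * L f + L g) /\
  (forall f, bm f -> (forall x, 0 <= f x) -> 0 <= L f).

Section linear.
Variable L : (T -> R) -> R.
Hypothesis linL : forall (a : R) f g, bm f -> bm g ->
  L (fun x => a * f x + g x) = a * L f + L g.

Lemma lin0 : L (fun=> 0) = 0.
Proof.
have := linL 1 (bm_cst 0) (bm_cst 0).
under eq_fun do rewrite mul1r addr0.
by rewrite mul1r; lra.
Qed.

Lemma linZ a f : bm f -> L (fun x => a * f x) = a * L f.
Proof.
move=> bf; have := linL a bf (bm_cst 0).
by under eq_fun do rewrite addr0; rewrite lin0 addr0.
Qed.

Lemma linD f g : bm f -> bm g -> L (fun x => f x + g x) = L f + L g.
Proof.
move=> bf bg; have := linL 1 bf bg.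
by under eq_fun do rewrite mul1r; rewrite mul1r.
Qed.

Lemma linB f g : bm f -> bm g -> L (fun x => f x - g x) = L f - L g.
Proof.
move=> bf bg; have := linL (- 1) bg bf.
under eq_fun do rewrite mulN1r addrC.
by move=> ->; rewrite mulN1r addrC.
Qed.

Lemma lin_cst c : L (fun=> c) = c * L (fun=> 1).
Proof.
by rewrite -linZ; [under [in RHS]eq_fun do rewrite mulr1|exact: bm_cst].
Qed.

Lemma lin_sum I (r : seq I) (P : pred I) (F : I -> T -> R) :
  (forall i, bm (F i)) ->
  L (fun x => \sum_(i <- r | P i) F i x) = \sum_(i <- r | P i) L (F i).
Proof.
move=> bF; elim: r => [|i r IH].
  by under eq_fun do rewrite big_nil; rewrite big_nil lin0.
under eq_fun do rewrite big_cons.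
rewrite big_cons; case: (P i) => //.
by rewrite linD ?IH//; exact: bm_sum.
Qed.

End linear.

Section positive.
Variable L : (T -> R) -> R.
Hypothesis pL : plf L.

Lemma plf_le f g : bm f -> bm g -> (forall x, f x <= g x) -> L f <= L g.
Proof.
move=> bf bg fg; rewrite -subr_ge0 -(linB pL.1)//.
by apply: pL.2; [exact: bmB|move=> x; rewrite subr_ge0].
Qed.

Lemma plf1_ge0 : 0 <= L (fun=> 1).
Proof. by apply: pL.2 => //; exact: bm_cst. Qed.

Lemma plf_norm_le f (c : R) : bm f -> (forall x, `|f x| <= c) ->
  `|L f| <= c * L (fun=> 1).
Proof.
move=> bf fc; rewrite -(lin_cst pL.1) ler_norml; apply/andP; split.
  rewrite -mulN1r -(linZ pL.1) ?plf_le//; [exact/bmZ/bm_cst| |exact: bm_cst].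
  by move=> x; rewrite mulN1r; have := fc x; rewrite ler_norml => /andP[].
apply: plf_le => //; first exact: bm_cst.
by move=> x; have := fc x; rewrite ler_norml => /andP[].
Qed.

Lemma plf_norm f : bm f -> `|L f| <= L (fun x => `|f x|).
Proof.
move=> bf; rewrite ler_norml; apply/andP; split.
  rewrite -mulN1r -(linZ pL.1); last exact: bm_norm.
  apply: plf_le => //; first exact/bmZ/bm_norm.
  by move=> x; rewrite mulN1r lerNl -normrN ler_norm.
by apply: plf_le => // [|x]; [exact: bm_norm|exact: ler_norm].
Qed.

Lemma plf_blf : blf L.
Proof.
split; first exact: pL.1.
by exists (L (fun=> 1)) => f c bf fc; rewrite mulrC plf_norm_le.
Qed.

End positive.

Lemma blfB L1 L2 : blf L1 -> blf L2 -> blf (fun f => L1 f - L2 f).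
Proof.
move=> [l1 [C1 b1]] [l2 [C2 b2]]; split.
  by move=> a f g bf bg; rewrite l1// l2//; ring.
exists (C1 + C2) => f c bf fc.
by rewrite (le_trans (ler_normB _ _))// mulrDl lerD ?b1 ?b2.
Qed.

(* [stair M y] is the integer part of [y], for [0 <= y <= M]. *)
Definition stair (M : nat) (y : R) : R := \sum_(i < M) (i.+1%:R <= y)%R%:R.

Lemma stairP M y : 0 <= y ->
  (y <= M%:R -> y - 1 <= stair M y <= y) /\ (M%:R <= y -> stair M y = M%:R).
Proof.
move=> y0; rewrite /stair; elim: M => [|M [IH1 IH2]].
  by rewrite big_ord0; split=> //; lra.
rewrite big_ord_recr/=; split=> [yM|My].
  case: (leP y M%:R) => My.
    have -> : (M.+1%:R <= y) = false.
      by apply/negbTE; rewrite -ltNge (le_lt_trans My)// ltr_nat.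
    by rewrite addr0; exact: IH1.
  rewrite IH2 ?(ltW My)//; move: yM; rewrite -natr1 => yM.
  by case: (leP (M%:R + 1) y) => h /=; lra.
rewrite My IH2; first by rewrite -natr1.
by rewrite (le_trans _ My)// ler_nat.
Qed.

(** A nonnegative bounded function is within [1 / N] of a nonnegative combination of indicators of
    its level sets, and [L] is continuous for the uniform norm. No sigma-additivity of [L]
    enters. *)
Lemma blf_ge0 L : blf L ->
  (forall A, measurable A -> 0 <= L \1_A) ->
  forall f, bm f -> (forall x, 0 <= f x) -> 0 <= L f.
Proof.
move=> [linL [C bL]] L0 f bf f0.
have [c c0 fc] := bm_ub bf.
have {}bL g (e : R) : bm g -> (forall x, `|g x| <= e) -> `|L g| <= `|C| * e.
  move=> bg ge; apply: (le_trans (bL _ _ bg ge)).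
  by rewrite ler_wpM2r ?ler_norm// (le_trans _ (ge point)).
apply/ler_addgt0Pr => e e0.
(* Mesh [1 / N] fine enough that the approximation costs at most [e] under [L]; [M] below bounds
   [N f], so the staircase is never cut off. *)
pose N := (Num.truncn ((`|C| + 1) / e)).+1.
have N0 : (0 < N%:R :> R) by rewrite ltr0n.
have CN : `|C| * N%:R^-1 <= e.
  have := truncnS_gt ((`|C| + 1) / e); rewrite -/N => h.
  rewrite ler_pdivrMr//; have {}h := ltW h.
  rewrite ler_pdivrMr// in h; nra.
pose M := (Num.truncn (N%:R * c)).+1.
have NcM : N%:R * c <= M%:R by rewrite ltW// truncnS_gt.
pose A i := [set x | i.+1%:R <= N%:R * f x].
have mA i : measurable (A i).
  have : measurable_fun setT (fun x => N%:R * f x) by case: (bmZ N%:R bf).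
  move=> /(_ measurableT `[i.+1%:R, +oo[%classic (measurable_itv _)).
  rewrite setTI; congr (measurable _); apply/seteqP; split=> x /=;
  by rewrite in_itv/= andbT.
pose g x : R := N%:R^-1 * \sum_(i < M) \1_(A i) x.
have gE x : g x = N%:R^-1 * stair M (N%:R * f x).
  by congr (_ * _); apply: eq_bigr => i _; rewrite indicE mem_setE.
have bg : bm g by apply/bmZ/bm_sum => i; exact: bm_indic.
have fg x : `|f x - g x| <= N%:R^-1.
  rewrite gE; have Nf0 : 0 <= N%:R * f x by rewrite mulr_ge0// ltW.
  have [h _] := @stairP M _ Nf0.
  have /h/andP[h1 h2] : N%:R * f x <= M%:R.
    by rewrite (le_trans _ NcM)// ler_pM2l// (le_trans _ (fc x))// ler_norm.
  rewrite -[X in X - _](mulKf (lt0r_neq0 N0)) -mulrBr normrM gtr0_norm ?invr_gt0//.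
  by rewrite ler_piMr ?invr_ge0 ?(ltW N0)// ler_norml; apply/andP; split; lra.
have Lg : 0 <= L g.
  rewrite (linZ linL); last by apply: bm_sum => i; exact: bm_indic.
  rewrite mulr_ge0 ?invr_ge0 ?(ltW N0)// (lin_sum linL).
    by apply: sumr_ge0 => i _; exact: L0.
  by move=> i; exact: bm_indic.
have := bL _ _ (bmB bf bg) fg; rewrite (linB linL)// ler_norml => /andP[h _].
lra.
Qed.

(** Positivity of both differences settles nonnegative functions; adding a constant settles the
    rest. This carries the identities for iterated kernels, the quasi-stationary distribution and
    conditional probabilities from sets to functions. *)
Lemma plf_ext L1 L2 : blf L1 -> blf L2 ->
  (forall A, measurable A -> L1 \1_A = L2 \1_A) ->
  forall f, bm f -> L1 f = L2 f.
Proof.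
move=> b1 b2 e f bf.
have ge0 g : bm g -> (forall x, 0 <= g x) -> L1 g = L2 g.
  move=> bg g0; apply/eqP; rewrite eq_le; apply/andP; split; rewrite -subr_ge0.
    by apply: (blf_ge0 (blfB b2 b1) _ bg g0) => A mA; rewrite e// subrr.
  by apply: (blf_ge0 (blfB b1 b2) _ bg g0) => A mA; rewrite e// subrr.
have [c c0 fc] := bm_ub bf.
have h := ge0 (fun x => c + f x) (bmD (bm_cst c) bf).
have h1 := ge0 _ (bm_cst c) (fun=> c0).
have {h} : L1 (fun x => c + f x) = L2 (fun x => c + f x).
  by apply: h => x; have := fc x; rewrite ler_norml => /andP[]; lra.
by rewrite (linD b1.1) ?(linD b2.1) ?h1//; [exact: addrI|exact: bm_cst..].
Qed.

End bounded_measurable.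

Arguments bm_cst {d T R} c.

Section integral_plf.
Context d (T : measurableType d) (R : realType).
Variable mu : {measure set T -> \bar R}.
Hypothesis mufin : (mu setT < +oo)%E.

Lemma bm_integrable (f : T -> R) : bm f -> mu.-integrable setT (EFin \o f).
Proof.
move=> [mf [c fc]].
apply: measurable_bounded_integrable => //.
exists c; split; first exact: num_real.
by move=> M cM x _; exact: le_trans (fc x) (ltW cM).
Qed.

Lemma plf_Rintegral : plf (fun f : T -> R => \int[mu]_x f x).
Proof.
split=> [a f g bf bg|f bf f0]; last exact: Rintegral_ge0.
rewrite RintegralD ?RintegralZl//; apply: bm_integrable => //.
exact: bmZ.
Qed.

Lemma Rintegral_indic (A : set T) : measurable A ->
  \int[mu]_x \1_A x = fine (mu A).
Proof. by move=> mA; rewrite /Rintegral/= integral_indic// setIT. Qed.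

End integral_plf.

Lemma cvg_dist_le (R : realType) (u e : nat -> R) (l : R) :
  (forall n, `|u n - l| <= e n) -> e n @[n --> \oo] --> 0 ->
  u n @[n --> \oo] --> l.
Proof.
move=> ue e0; apply/subr_cvg0/norm_cvg0P.
apply: (squeeze_cvgr (f := fun=> 0) (h := e)) => //; last exact: cvg_cst.
by apply: nearW => n; rewrite normr_ge0 ue.
Qed.

Section positive_operators.
Context d (T : measurableType d) (R : realType).
Implicit Types f g : T -> R.

Definition pop (Q : (T -> R) -> T -> R) :=
  (forall f, bm f -> bm (Q f)) /\ forall x, plf (Q ^~ x).

Lemma plf_pop L Q : plf L -> pop Q -> plf (L \o Q).
Proof.
move=> pL [bQ pQ]; split=> [a f g bf bg|f bf f0] /=.
  rewrite -pL.1; [|exact: bQ..]; congr L; apply/funext => x.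
  exact: (pQ x).1.
by apply: pL.2; [exact: bQ|move=> x; exact: (pQ x).2].
Qed.

Lemma pop_comp Q1 Q2 : pop Q1 -> pop Q2 -> pop (Q1 \o Q2).
Proof.
move=> [b1 p1] p2; split; first by move=> f bf; exact/b1/p2.1.
by move=> x; exact: (plf_pop (p1 x)).
Qed.

Lemma pop_iter n Q : pop Q -> pop (iter n Q).
Proof.
move=> pQ; elim: n => [|n IH]; first by split => // x; split => /=.
exact: (pop_comp pQ IH).
Qed.

Lemma bm_iter n Q f : pop Q -> bm f -> bm (iter n Q f).
Proof. by move=> /(pop_iter n) [+ _]; exact. Qed.

Lemma pop_ge0 Q f x : pop Q -> bm f -> (forall y, 0 <= f y) -> 0 <= Q f x.
Proof. by move=> [_ pQ]; exact: (pQ x).2. Qed.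

Lemma plf_cvg L (F : nat -> T -> R) f (e : nat -> R) : plf L ->
  (forall n, bm (F n)) -> bm f -> (forall n x, `|F n x - f x| <= e n) ->
  e n @[n --> \oo] --> 0 -> L (F n) @[n --> \oo] --> L f.
Proof.
move=> pL bF bf Fe e0; apply: (@cvg_dist_le _ _ (fun n => e n * L (fun=> 1))).
  move=> n; rewrite -(linB pL.1)//; apply: plf_norm_le => //.
  by apply: bmB.
by rewrite -[X in _ --> X](mul0r (L (fun=> 1))); exact: cvgMl.
Qed.

End positive_operators.

(** * The potential operator *)

Section potential.
Context d (T : measurableType d) (R : realType).
Implicit Types f g : T -> R.
Variables (Q : (T -> R) -> T -> R) (D t : R).
Hypotheses (pQ : pop Q) (t0 : 0 < t) (t1 : t < 1).
Hypothesis geo : forall n x, iter n Q (fun=> 1) x <= D * t ^+ n.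

Definition potential f x : R := limn (series (fun n => iter n Q f x)).

Let psum f J x : R := \sum_(i < J) iter i Q f x.

Let D0 : 0 <= D.
Proof. by have := geo 0 point; rewrite expr0 mulr1; exact: le_trans. Qed.

Lemma iter_norm_le f c n x : bm f -> (forall y, `|f y| <= c) ->
  `|iter n Q f x| <= c * (D * t ^+ n).
Proof.
move=> bf fc; apply: (le_trans (plf_norm_le ((pop_iter n pQ).2 x) bf fc)).
by rewrite ler_wpM2l// (le_trans _ (fc x)).
Qed.

Let bm_psum f J : bm f -> bm (psum f J).
Proof. by move=> bf; apply: bm_sum => i; exact: bm_iter. Qed.

Let is_cvg_potential f x : bm f -> cvgn (series (fun n => iter n Q f x)).
Proof.
move=> bf; have [c c0 fc] := bm_ub bf; apply: normed_cvg.
apply: (@series_le_cvg _ _ (geometric (c * D) t)).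
- by move=> n; exact: normr_ge0.
- by move=> n; rewrite /geometric/= !mulr_ge0 ?exprn_ge0// ltW.
- by move=> n; rewrite /geometric/= -mulrA; exact: iter_norm_le.
- by apply: is_cvg_geometric_series; rewrite gtr0_norm.
Qed.

Lemma cvg_potential f x : bm f -> psum f J x @[J --> \oo] --> potential f x.
Proof.
by move=> /is_cvg_potential => /(_ x); rewrite /potential seriesEord; exact.
Qed.

Lemma potential_tail f c J x : bm f -> (forall y, `|f y| <= c) ->
  `|psum f J x - potential f x| <= c * D / (1 - t) * t ^+ J.
Proof.
move=> bf fc; have c0 : 0 <= c by exact: le_trans (fc point).
have cD0 : 0 <= c * D by rewrite mulr_ge0.
have t1' : 0 < 1 - t by rewrite subr_gt0.
have ct0 : 0 <= c * D / (1 - t) by rewrite mulr_ge0// invr_ge0 ltW.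
(* The geometric block is written as a difference of powers, so that the induction on [k]
   telescopes. *)
have step k : `|psum f J x - psum f (k + J) x| <=
    c * D / (1 - t) * (t ^+ J - t ^+ (k + J)).
  elim: k => [|k IH]; first by rewrite !subrr normr0 mulr0.
  rewrite addSn /psum big_ord_recr/= opprD addrA.
  rewrite (le_trans (ler_normB _ _))//.
  have -> : c * D / (1 - t) * (t ^+ J - t ^+ (k + J).+1) =
    c * D / (1 - t) * (t ^+ J - t ^+ (k + J)) + c * (D * t ^+ (k + J)).
    by rewrite exprS; field; rewrite lt0r_neq0.
  by rewrite lerD// iter_norm_le.
have h : `|psum f J x - psum f k x| @[k --> \oo] -->
    `|psum f J x - potential f x|.
  by apply: cvg_norm; apply: cvgB; [exact: cvg_cst|exact: cvg_potential].
rewrite -(cvg_lim _ h)//; apply: limr_le; first by apply/cvg_ex; eexists; exact: h.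
exists J => // k /= Jk; rewrite -(subnK Jk).
apply: (le_trans (step _)); rewrite ler_wpM2l//.
by rewrite gerBl exprn_ge0// ltW.
Qed.

Let tail0 a : a * t ^+ J @[J --> \oo] --> 0.
Proof.
rewrite -[X in _ --> X](mulr0 a); apply: cvgMr.
by apply: cvg_expr; rewrite gtr0_norm.
Qed.

Lemma bm_potential f : bm f -> bm (potential f).
Proof.
move=> bf; have [c c0 fc] := bm_ub bf.
apply: (@bm_lim _ _ _ (fun J => psum f J) _ (c * D / (1 - t))).
- by move=> J; exact: bm_psum.
- move=> x; have := potential_tail 0 x bf fc.
  by rewrite /psum big_ord0 sub0r normrN expr0 mulr1.
- by move=> x; exact: cvg_potential.
Qed.

Lemma potential_psum_ge f J x : bm f -> (forall y, 0 <= f y) ->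
  psum f J x <= potential f x.
Proof.
move=> bf f0; rewrite -(cvg_lim _ (@cvg_potential f x bf))//.
apply: limr_ge; first by apply/cvg_ex; eexists; exact: (@cvg_potential f x bf).
exists J => // k /= Jk; rewrite -(subnK Jk) addnC /psum big_split_ord/= lerDl.
by apply: sumr_ge0 => i _; apply: pop_ge0 => //; exact: pop_iter.
Qed.

Lemma pop_potential : pop potential.
Proof.
split; first exact: bm_potential.
move=> x; split => [a f g bf bg|f bf f0].
  have bfg := bmD (bmZ a bf) bg.
  apply: (cvg_unique _ (@cvg_potential _ x bfg)) => //.
  have -> : (fun J => psum (fun x => a * f x + g x) J x) =
      (fun J => a * psum f J x + psum g J x).
    apply/funext => J; rewrite /psum mulr_sumr -big_split/=.
    by apply: eq_bigr => i _; rewrite ((pop_iter i pQ).2 x).1.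
  by apply: cvgD; [apply: cvgMr|]; exact: cvg_potential.
have := potential_psum_ge 0 x bf f0.
by rewrite /psum big_ord0.
Qed.

Lemma plf_cvg_potential L f : plf L -> bm f ->
  \sum_(i < J) L (iter i Q f) @[J --> \oo] --> L (potential f).
Proof.
move=> pL bf; have [c c0 fc] := bm_ub bf.
have -> : (fun J => \sum_(i < J) L (iter i Q f)) = (fun J => L (psum f J)).
  apply/funext => J; rewrite -[RHS]/(L (fun x => _)) /psum (lin_sum pL.1)//.
  by move=> i; exact: bm_iter.
apply: (plf_cvg pL (fun J => bm_psum J bf) (bm_potential bf)).
  by move=> J x; exact: (potential_tail J x bf fc).
exact: tail0.
Qed.

Lemma potentialE f x : bm f -> potential f x = f x + Q (potential f) x.
Proof.
move=> bf; have h := plf_cvg_potential (pQ.2 x) bf.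
have {}h : psum f J.+1 x @[J --> \oo] --> f x + Q (potential f) x.
  under eq_fun do rewrite /psum big_ord_recl.
  by apply: cvgD; [exact: cvg_cst|exact: h].
have g : psum f J.+1 x @[J --> \oo] --> potential f x.
  by rewrite (cvg_shiftS (fun J => psum f J x)); exact: cvg_potential.
exact: (cvg_unique _ g h).
Qed.

Lemma potentialEn J f x : bm f ->
  potential f x = \sum_(i < J) iter i Q f x + iter J Q (potential f) x.
Proof.
move=> bf; elim: J => [|J IH]; first by rewrite big_ord0 add0r.
rewrite IH big_ord_recr/= -addrA; congr +%R.
rewrite -iterS iterSr -(linD ((pop_iter J pQ).2 x).1)//.
- by congr (iter J Q _ x); apply/funext => y; exact: potentialE.
- by apply: pQ.1; exact: bm_potential.
Qed.

Lemma potential_ge f x : bm f -> (forall y, 0 <= f y) -> f x <= potential f x.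
Proof.
by move=> bf f0; have := potential_psum_ge 1 x bf f0; rewrite /psum big_ord1.
Qed.

Lemma potential1_le x : potential (fun=> 1) x <= D / (1 - t).
Proof.
have := @potential_tail (fun=> 1) 1 0 x (bm_cst 1).
rewrite /psum big_ord0 sub0r normrN expr0 mulr1 mul1r => h.
by apply: (le_trans (ler_norm _)); apply: h => y; rewrite normr1.
Qed.

End potential.

(** * Contraction of the iterated potential *)

Section contraction.
Context d (T : measurableType d) (R : realType).
Implicit Types f g : T -> R.
Variables (A : (T -> R) -> T -> R) (Psi mustar : (T -> R) -> R).
Variables (B c Lam : R) (th : nat -> R).
Hypotheses (pA : pop A) (pPsi : plf Psi) (pmu : plf mustar).
Hypotheses (Psi1 : Psi (fun=> 1) = 1) (mu1 : mustar (fun=> 1) = 1).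
Hypothesis A_ge : forall f x, bm f -> (forall y, 0 <= f y) -> f x <= A f x.
Hypothesis A1 : forall x, A (fun=> 1) x <= B.
Hypotheses (c0 : 0 < c) (th0 : forall N, 0 <= th N).
Hypothesis minor : forall f x, bm f -> (forall y, 0 <= f y) ->
  c * Psi f <= A (A f) x.
Hypothesis muA : forall f, bm f -> mustar (A f) = Lam * mustar f.
Hypothesis thP : forall N x,
  th N * iter N A (fun=> 1) x <= Psi (iter N A (fun=> 1)).

Let bmA N f : bm f -> bm (iter N A f). Proof. exact: bm_iter. Qed.

Let iterA_ge1 N x : 1 <= iter N A (fun=> 1) x.
Proof.
elim: N x => [//|N IH] x; rewrite iterS (le_trans (IH x))// A_ge//.
  exact/bmA/bm_cst.
by move=> y; rewrite (le_trans ler01).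
Qed.

Let B_ge1 : 1 <= B.
Proof.
by rewrite (le_trans _ (A1 point))// A_ge//; exact: bm_cst.
Qed.

Let ratio (N : nat) g (m M : R) := forall x,
  m * iter N A (fun=> 1) x <= iter N A g x <= M * iter N A (fun=> 1) x.

Let ratio_le N g m M : ratio N g m M -> m <= M.
Proof.
move=> /(_ point)/andP[h1 h2]; have := le_trans h1 h2.
by rewrite ler_pM2r// (lt_le_trans ltr01).
Qed.

(** Doeblin argument with [p = Psi b / Psi a]. Since [b - m a >= 0], the minorization gives
    [A A b - m A A a >= c (p - m) Psi a], and [Psi a] is at least [th N / B ^+ 2] times [A A a]. So
    the lower bound rises by [k (p - m)]; symmetrically the upper one drops by [k (M - p)], and the
    width loses the fraction [k] whatever [p] is. The index grows by 2 because it is [A A] that is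
    minorized. *)
Let ratio_step N g m M : bm g -> ratio N g m M ->
  exists m' M', M' - m' = (1 - c * th N / B ^+ 2) * (M - m) /\
    ratio N.+2 g m' M'.
Proof.
move=> bg rg; have mM := ratio_le rg.
set a := iter N A (fun=> 1); set b := iter N A g.
have ba : bm a by exact/bmA/bm_cst.
have bb : bm b by exact: bmA.
have B0 : 0 < B by rewrite (lt_le_trans ltr01).
have Pa1 : 1 <= Psi a.
  by rewrite -Psi1; apply: plf_le => // ; [exact: bm_cst|exact: iterA_ge1].
have Pa0 : 0 < Psi a by rewrite (lt_le_trans ltr01).
pose p := Psi b / Psi a.
have Pb : Psi b = p * Psi a by rewrite /p divfK// lt0r_neq0.
set k := c * th N / B ^+ 2.
have AAlin e h x : bm h -> A (A (fun y => e * a y + h y)) x =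
    e * A (A a) x + A (A h) x.
  by move=> bh; exact: ((pop_comp pA pA).2 x).1.
have AAa x : th N * A (A a) x <= B ^+ 2 * Psi a.
  have AA1 : A (A (fun=> 1)) x <= B ^+ 2.
    apply: (@le_trans _ _ (A (fun=> B * 1) x)).
      apply: (plf_le (pA.2 x)); [exact/pA.1/bm_cst|exact: bm_cst|].
      by move=> y; rewrite mulr1.
    rewrite (linZ (pA.2 x).1); last exact: bm_cst.
    by rewrite expr2 ler_pM2l.
  rewrite -[leLHS](linZ ((pop_comp pA pA).2 x).1)//.
  apply: (@le_trans _ _ (A (A (fun=> Psi a)) x)).
    apply: (plf_le ((pop_comp pA pA).2 x)); [exact: bmZ|exact: bm_cst|].
    by move=> y; exact: thP.
  rewrite -[leLHS]/((A \o A) (fun=> Psi a) x).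
  rewrite (lin_cst ((pop_comp pA pA).2 x).1)/= mulrC.
  by rewrite ler_pM2r.
have kP x : k * A (A a) x <= c * Psi a.
  have -> : k * A (A a) x = c * (th N * A (A a) x / B ^+ 2) by rewrite /k; ring.
  by rewrite ler_pM2l// ler_pdivrMr ?exprn_gt0// [leRHS]mulrC.
have k0 : 0 <= k by rewrite /k !mulr_ge0 ?invr_ge0 ?exprn_ge0// ltW.
have mp : m <= p.
  rewrite /p ler_pdivlMr// -(linZ pPsi.1)//; apply: (plf_le pPsi) => //.
    exact: bmZ.
  by move=> x; have /andP[] := rg x.
have pM : p <= M.
  rewrite /p ler_pdivrMr// -(linZ pPsi.1)//; apply: (plf_le pPsi) => //.
    exact: bmZ.
  by move=> x; have /andP[] := rg x.
exists (m + k * (p - m)), (M - k * (M - p)); split; first by ring.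
move=> x; rewrite -[iter _ A (fun=> 1) x]/(A (A a) x).
rewrite -[iter _ A g x]/(A (A b) x).
have bNb : bm (fun y => -1 * b y) by exact: bmZ.
have hM : c * (M * Psi a - Psi b) <= M * A (A a) x - A (A b) x.
  have /(_ x) := minor _ (bmD (bmZ M ba) bNb).
  rewrite AAlin// pPsi.1// (linZ pPsi.1)//.
  rewrite -[A (A (fun y => -1 * b y)) x]/((A \o A) (fun y => -1 * b y) x).
  rewrite (linZ ((pop_comp pA pA).2 x).1)//= !mulN1r; apply => y.
  by rewrite mulN1r subr_ge0; have /andP[] := rg y.
have hm : c * (Psi b - m * Psi a) <= A (A b) x - m * A (A a) x.
  have /(_ x) := minor _ (bmD (bmZ (- m) ba) bb).
  rewrite AAlin// pPsi.1// !mulNr ![- _ + _]addrC; apply => y.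
  by rewrite mulNr addrC subr_ge0; have /andP[] := rg y.
have kx := kP x.
rewrite -subr_ge0 in mp; rewrite -subr_ge0 in pM.
have h1 := ler_wpM2r mp kx; have h2 := ler_wpM2r pM kx.
rewrite Pb in hM hm.
move: hM hm h1 h2; set u := A (A a) x; set v := A (A b) x; set q := Psi a.
move=> hM hm h1 h2.
by apply/andP; split; lra.
Qed.

(** By [1 - x <= exp (- x)] the widths are bounded by an exponential of minus the sum of the gaps.
    As [mustar (A^N g)] stays 0, the interval of ratios contains 0, so its width bounds the ratios
    themselves. *)
Lemma iter_ratio_cvg0 g : bm g -> mustar g = 0 ->
  (forall H, exists k, H <= \sum_(j < k) th j.*2) ->
  forall e, 0 < e -> exists N, forall x,
    `|iter N A g x| <= e * iter N A (fun=> 1) x.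
Proof.
move=> bg mug thoo e e0; have [b b0 gb] := bm_ub bg.
have B0 : 0 < B by rewrite (lt_le_trans ltr01).
pose k0 := c / B ^+ 2.
have k0gt : 0 < k0 by rewrite divr_gt0// exprn_gt0.
have main k : exists m M, ratio k.*2 g m M /\
    (M - m) <= expR (- (k0 * \sum_(j < k) th j.*2)) * (2 * b).
  elim: k => [|k [m [M [rg IH]]]].
    exists (- b), b; split; last by rewrite big_ord0 mulr0 oppr0 expR0; lra.
    by move=> x /=; have := gb x; rewrite ler_norml !mulr1.
  have [m' [M' [E rg']]] := ratio_step bg rg.
  exists m', M'; split => //; rewrite E big_ord_recr/= [k0 * (_ + _)]mulrDr opprD expRD.
  rewrite [expR _ * expR _]mulrC.
  rewrite (_ : c * _ / _ = k0 * th k.*2); last by rewrite /k0; ring.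
  apply: (@le_trans _ _ (expR (- (k0 * th k.*2)) * (M - m))).
    by rewrite ler_wpM2r ?expR_ge1Dx// subr_ge0 (ratio_le rg).
  rewrite -[leRHS]mulrA.
  by rewrite ler_pM2l ?expR_gt0.
(* The initial width is [2 * b]. Making the exponent [S] at least [2 * b / e] suffices, because
   [S <= exp S]. *)
have [k kH] := thoo (2 * b / e / k0).
have [m [M [rg Mm]]] := main k.
have MN N : mustar (iter N A g) = 0.
  by elim: N => [//|N IH]; rewrite iterS muA ?IH ?mulr0//; exact: bmA.
set a := iter k.*2 A (fun=> 1).
have ba : bm a by exact/bmA/bm_cst.
have mua : 1 <= mustar a.
  by rewrite -mu1; apply: plf_le => //; [exact: bm_cst|exact: iterA_ge1].
have Mme : M - m <= e.
  apply: (le_trans Mm); set S := k0 * _.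
  have S1 : 2 * b / e <= S by rewrite /S [leRHS]mulrC -ler_pdivrMr.
  have S2 : 2 * b / e <= expR S by rewrite (le_trans _ (expR_ge1Dx _))//; lra.
  by rewrite expRN mulrC ler_pdivrMr ?expR_gt0// [leRHS]mulrC -ler_pdivrMr.
(* Integrating the two-sided bound against [mustar] gives [m * mustar a <= 0 <= M * mustar a], with
   [mustar a >= 1]. *)
have m0 : m <= 0.
  have : m * mustar a <= 0.
    rewrite -(MN k.*2) -(linZ pmu.1)//; apply: plf_le => //.
    - exact: bmZ.
    - exact: bmA.
    - by move=> x; have /andP[] := rg x.
  by nra.
have M0 : 0 <= M.
  have : 0 <= M * mustar a.
    rewrite -(MN k.*2) -(linZ pmu.1)//; apply: plf_le => //.
    - exact: bmA.
    - exact: bmZ.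
    - by move=> x; have /andP[] := rg x.
  by nra.
exists k.*2 => x; have /andP[h1 h2] := rg x.
have := iterA_ge1 k.*2 x; rewrite -/a in h1 h2 * => a1.
by rewrite ler_norml; apply/andP; split; nra.
Qed.

End contraction.

(** * Transfer of the survival ratio from [Q] to its potential *)

Section survival_ratio.
Context d (T : measurableType d) (R : realType).
Implicit Types f g : T -> R.
Variables (Q : (T -> R) -> T -> R) (D t : R).
Hypotheses (pQ : pop Q) (t0 : 0 < t) (t1 : t < 1).
Hypothesis geo : forall n x, iter n Q (fun=> 1) x <= D * t ^+ n.
Variables (Psi : (T -> R) -> R) (C : nat -> R).
Hypotheses (pPsi : plf Psi) (C0 : forall n, 0 <= C n).
Hypothesis C_noninc : forall m n, (m <= n)%N -> C n <= C m.
Hypothesis CP : forall n x,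
  C n * iter n Q (fun=> 1) x <= Psi (iter n Q (fun=> 1)).

Local Notation A := (potential Q).
Local Notation one := (fun _ : T => 1 : R).

(* The part of the expansion [A^N 1 = sum_n 'C(n + N - 1, n) Q^n 1] of degree at
   most [M] in [Q]. *)
Fixpoint trunc_potential (N M : nat) (x : T) : R :=
  if N is N'.+1 then
    \sum_(k < M.+1) iter k Q (trunc_potential N' (M - k)) x
  else 1.

Local Notation G := trunc_potential.

Let pA : pop A. Proof. exact: (pop_potential pQ t0 t1 geo). Qed.

Let bmG N M : bm (G N M).
Proof.
elim: N M => [|N IH] M; first exact: bm_cst.
by apply: bm_sum => k; exact: bm_iter.
Qed.

Let bmA1 N : bm (iter N A one).
Proof. by apply: bm_iter => //; exact: bm_cst. Qed.

Let iterA_ge0 N x : 0 <= iter N A one x.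
Proof. by apply: pop_ge0 => //; [exact: pop_iter|exact: bm_cst]. Qed.

Let iterA_ge1 N x : 1 <= iter N A one x.
Proof.
elim: N x => [//|N IH] x; rewrite iterS (le_trans (IH x))//.
apply: (potential_ge pQ t0 t1 geo); first exact: bmA1.
by move=> y; exact: iterA_ge0.
Qed.

(** Every term on the left is some [Q^n 1] with [j <= n <= M + j], for which [C (M + j) <= C n]. The
    exponent [j] is there for the induction: opening one potential moves [k] powers from the budget
    [M] to [j] and leaves [M + j] unchanged. *)
Let trunc_lb N j M x :
  C (M + j) * iter j Q (G N M) x <= Psi (iter j Q (iter N A one)).
Proof.
elim: N j M x => [|N IH] j M x /=.
  apply: le_trans (CP j x); rewrite ler_wpM2r ?C_noninc ?leq_addl//.
  by apply: pop_ge0 => //; [exact: pop_iter|exact: bm_cst].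
set h := iter N A one.
have bh n : bm (iter n Q h) := bm_iter n pQ (bmA1 N).
have -> : iter j Q (G N.+1 M) x =
    \sum_(k < M.+1) iter (j + k) Q (G N (M - k)) x.
  under [RHS]eq_bigr do rewrite iterD.
  rewrite -(lin_sum ((pop_iter j pQ).2 x).1)// => k; exact: bm_iter.
apply: (@le_trans _ _ (\sum_(k < M.+1) Psi (iter (j + k) Q h))).
  rewrite mulr_sumr; apply: ler_sum => k _.
  have -> : (M + j = (M - k) + (j + k))%N.
    by rewrite addnCA subnK 1?addnC// -ltnS.
  exact: IH.
rewrite -(lin_sum pPsi.1)//; apply: (plf_le pPsi).
- exact: bm_sum.
- by apply: bm_iter => //; exact: (pA.1 _ (bmA1 N)).
- move=> y; under eq_bigr do rewrite iterD.
  rewrite -(lin_sum ((pop_iter j pQ).2 y).1)//.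
  apply: (plf_le ((pop_iter j pQ).2 y)); [exact: bm_sum|exact: (pA.1 _ (bmA1 N))|].
  move=> z; apply: (potential_psum_ge pQ t0 t1 geo); [exact: bmA1|exact: iterA_ge0].
Qed.

(** A rate strictly between [t] and 1. The slack [r = t / s < 1] makes the sum of [s^(M-k) t^k] over
    [k <= M] at most [s^M / (1 - r)], with no factor growing with [M]. *)
Let s := (t + 1) / 2.
Let ts : t < s. Proof. by move: t1; rewrite /s; lra. Qed.
Let s0 : 0 < s. Proof. exact: lt_trans ts. Qed.
Let s1 : s < 1. Proof. by move: t1; rewrite /s; lra. Qed.
Let r := t / s.
Let r0 : 0 < r. Proof. exact: divr_gt0. Qed.
Let r1 : r < 1. Proof. by rewrite ltr_pdivrMr ?mul1r. Qed.
Let B' := D / (1 - t).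
Let B := D / (1 - r) + B' * D.
Let D1 : 1 <= D.
Proof. by have := geo 0 point; rewrite expr0 mulr1. Qed.
Let B'0 : 0 <= B'. Proof. by move: D1 t1 => *; rewrite divr_ge0//; lra. Qed.
Let BB : B' <= B.
Proof.
have : 0 <= D / (1 - r) by move: D1 r1 => *; rewrite divr_ge0//; lra.
by move: B'0 D1; rewrite /B; nra.
Qed.

Let iterA_ub N x : iter N A one x <= B ^+ N.
Proof.
elim: N x => [//|N IH] x; rewrite iterS exprSr.
apply: (@le_trans _ _ (A (fun=> B ^+ N) x)).
  by apply: (plf_le (pA.2 x)) => //; exact: bm_cst.
rewrite (lin_cst (pA.2 x).1) ler_wpM2l ?exprn_ge0 ?(le_trans B'0)//.
by rewrite (le_trans (potential1_le pQ t0 t1 geo x)).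
Qed.

(** The outer potential is split after degree [M]. Terms of degree at most [M] lose what the
    induction hypothesis allows with budget [M - k], which costs the factor [D / (1 - r)]; the
    remainder [Q^(M+1) A h] costs [B' * D]. The constant [B] is the sum of the two, so that the
    induction closes. *)
Let trunc_tail N M x : iter N A one x - G N M x <= s ^+ M * B ^+ N.
Proof.
have B0 : 0 <= B by exact: le_trans BB.
elim: N M x => [|N IH] M x /=.
  by rewrite subrr expr0 mulr1; exact: exprn_ge0 (ltW s0).
set h := iter N A one; have bh : bm h := bmA1 N.
rewrite (potentialEn pQ t0 t1 geo M.+1)// addrAC -sumrB.
have h1 : \sum_(k < M.+1) (iter k Q h x - iter k Q (G N (M - k)) x) <=
    s ^+ M * B ^+ N * (D / (1 - r)).
  apply: (@le_trans _ _ (s ^+ M * B ^+ N * D * \sum_(k < M.+1) r ^+ k)).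
    rewrite mulr_sumr; apply: ler_sum => k _.
    rewrite -(linB ((pop_iter k pQ).2 x).1)//.
    apply: (@le_trans _ _ (iter k Q (fun=> s ^+ (M - k) * B ^+ N) x)).
      apply: (plf_le ((pop_iter k pQ).2 x)); [exact: bmB|exact: bm_cst|].
      by move=> y; exact: IH.
    rewrite (lin_cst ((pop_iter k pQ).2 x).1).
    apply: (@le_trans _ _ (s ^+ (M - k) * B ^+ N * (D * t ^+ k))).
      by rewrite ler_wpM2l// mulr_ge0// exprn_ge0// ltW.
    have kM : (k <= M)%N by rewrite -ltnS.
    have -> : s ^+ M = s ^+ (M - k) * s ^+ k by rewrite -exprD subnK.
    have -> : r ^+ k = t ^+ k / s ^+ k by rewrite expr_div_n.
    have : s ^+ k != 0 by rewrite expf_neq0// lt0r_neq0.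
    move: (s ^+ k) (s ^+ (M - k)) (t ^+ k) (B ^+ N) => u v w z u0.
    by rewrite le_eqVlt; apply/orP; left; apply/eqP; field.
  rewrite mulrA ler_wpM2l//.
    by rewrite !mulr_ge0 ?exprn_ge0 ?(ltW s0) ?(le_trans ler01 D1).
  rewrite -[leRHS]mul1r ler_pdivlMr ?subr_gt0//.
  have := subrX1 r M.+1; have := exprn_ge0 M.+1 (ltW r0).
  by set S := \sum_(i < _) _; lra.
have h2 : iter M.+1 Q (A h) x <= s ^+ M * B ^+ N * (B' * D).
  apply: (@le_trans _ _ (iter M.+1 Q (fun=> B ^+ N * B') x)).
    apply: (plf_le ((pop_iter M.+1 pQ).2 x)); [exact: pA.1|exact: bm_cst|].
    move=> y; apply: (@le_trans _ _ (A (fun=> B ^+ N) y)).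
      apply: (plf_le (pA.2 y)) => //; first exact: bm_cst.
      by move=> z; exact: iterA_ub.
    rewrite (lin_cst (pA.2 y).1) ler_wpM2l ?exprn_ge0//.
    exact: (potential1_le pQ t0 t1 geo).
  rewrite (lin_cst ((pop_iter M.+1 pQ).2 x).1).
  have -> : s ^+ M * B ^+ N * (B' * D) = B ^+ N * B' * (D * s ^+ M) by ring.
  apply: ler_wpM2l; first by rewrite mulr_ge0 ?exprn_ge0.
  apply: (le_trans (geo M.+1 x)).
  rewrite ler_pM2l ?(lt_le_trans ltr01)// exprS.
  rewrite (@le_trans _ _ (t ^+ M))//.
    by rewrite ler_piMl ?exprn_ge0 ?ltW.
  by rewrite lerXn2r ?nnegrE ?ltW.
apply: (le_trans (lerD h1 h2)).
by rewrite -mulrDr exprSr mulrA.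
Qed.

Lemma survival_ratio_ge : exists L : nat, forall N x,
  2^-1 * C (L.+1 * N)%N * iter N A one x <= Psi (iter N A one).
Proof.
have B0 : 0 <= B by exact: le_trans BB.
have sL : s ^+ L * B @[L --> \oo] --> 0.
  rewrite -[X in _ --> X](mul0r B); apply: cvgMl.
  by apply: cvg_expr; rewrite gtr0_norm.
(* With budget [L.+1 * N] the discarded part is at most [(s ^+ L.+1 * B) ^+ N], hence at most 1/2
   when [N > 0]. Since [A^N 1 >= 1], this is at most half of [A^N 1]. For [N = 0] the power is 1,
   hence the separate case. *)
have [L _ LP] : \forall L \near \oo, s ^+ L * B <= 2^-1.
  by apply: (cvgr_le 0) => //; rewrite invr_gt0.
exists L => N x.
have {}LP : s ^+ L.+1 * B <= 2^-1 by apply: LP => /=.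
have G2 : iter N A one x <= 2 * G N (L.+1 * N) x.
  case: N => [|N]; first by rewrite /=; lra.
  have := @trunc_tail N.+1 (L.+1 * N.+1) x.
  rewrite exprM -exprMn => h.
  have u0 : 0 <= s ^+ L.+1 * B by rewrite mulr_ge0 ?exprn_ge0// ltW.
  have {}h : iter N.+1 A one x - G N.+1 (L.+1 * N.+1) x <= 2^-1.
    rewrite (le_trans h)// exprS -[leRHS]mulr1 ler_pM ?exprn_ge0//.
    by rewrite exprn_ile1// (le_trans LP)//; lra.
  by have := iterA_ge1 N.+1 x; lra.
have := trunc_lb N 0 (L.+1 * N) x; rewrite addn0 /= => h.
apply: le_trans h; rewrite -mulrA mulrCA ler_wpM2l//; lra.
Qed.

End survival_ratio.

(** * Integral comparison and uniform positivity on a compact space *)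

(** On each block [[m j, m (j + 1)[] the function is at most its value at the left end, so a bound
    [H] on the sums would bound the integral by [m H]. *)
Lemma sum_noninc_unbounded (R : realType) (C : R -> R) (m : nat) :
  (0 < m)%N -> (forall s : R, 0 <= s -> 0 <= C s) ->
  {in `[0, +oo[ &, {homo C : s t / s <= t >-> t <= s}} ->
  (\int[lebesgue_measure]_(s in `[0%R, +oo[) (C s)%:E = +oo)%E ->
  forall H : R, exists k, H <= \sum_(j < k) C (m * j)%:R.
Proof.
move=> m0 C0 Cn Coo H; apply: contrapT => /forallNP h.
have {}h k : \sum_(j < k) C (m * j)%:R <= H.
  by rewrite leNgt; apply/negP => hk; apply: (h k); exact: ltW.
have CN (s t : R) : 0 <= s -> s <= t -> C t <= C s.
  by move=> s0 st; apply: Cn => //; rewrite in_itv/= andbT// (le_trans s0).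
pose I j : set R := `[(m * j)%:R, (m * j.+1)%:R[%classic.
have cover : `[0%R, +oo[%classic = \bigcup_j I j.
  apply/seteqP; split=> [s|s [j _]] /=; rewrite !in_itv/= ?andbT.
    move=> s0; exists (Num.truncn (s / m%:R)) => //=.
    have m0' : 0 < m%:R :> R by rewrite ltr0n.
    rewrite /I/= in_itv/= !natrM ![m%:R * _]mulrC -ler_pdivlMr// -ltr_pdivrMr//.
    by rewrite truncn_le ?truncnS_gt// divr_ge0.
  by rewrite /I/= in_itv/= => /andP[+ _]; exact: le_trans.
have mC (J : set R) : measurable J -> J `<=` `[0%R, +oo[%classic ->
    measurable_fun J (fun s => (C s)%:E).
  move=> mJ J0; apply/measurable_EFinP.
  (* [C] is monotone on the half-line only; composing with [Num.max 0] gives a function monotone on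
     the whole line. *)
  apply: (@eq_measurable_fun _ _ _ _ J (fun s => C (Num.max 0 s))).
    by move=> s /set_mem /J0/=; rewrite in_itv/= andbT => s0; rewrite max_r.
  apply: nonincreasing_measurable => // s t st.
  by apply: CN; [rewrite le_max lexx|rewrite ge_max !le_max lexx st orbT].
have I0 j : I j `<=` `[0%R, +oo[%classic.
  by rewrite cover => s Is; exists j.
have IC0 j s : I j s -> (0 <= (C s)%:E)%E.
  by move=> /I0; rewrite /= in_itv/= andbT lee_fin; exact: C0.
have mI j : measurable (I j) by exact: measurable_itv.
have lI j : lebesgue_measure (I j : set R) = m%:R%:E.
  rewrite /I lebesgue_measure_itv/= lte_fin ltr_nat ltn_pmul2l// ltnS leqnn.
  by rewrite -EFinD mulnS natrD addrK.
suff : (\int[lebesgue_measure]_(s in `[0%R, +oo[) (C s)%:E <= (m%:R * H)%:E)%E.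
  by rewrite Coo leNgt ltry.
rewrite cover ge0_integral_bigcup//.
- apply: lime_le.
    apply: is_cvg_nneseries => j _ _; apply: integral_ge0 => s.
    exact: IC0.
  apply: nearW => k.
  apply: (@le_trans _ _ (\sum_(0 <= j < k) (m%:R * C (m * j)%:R)%:E)%E).
    apply: lee_sum => j _.
    apply: (@le_trans _ _ (\int[lebesgue_measure]_(s in I j) (C (m * j)%:R)%:E)%E).
      apply: ge0_le_integral => //.
      - exact: mI.
      - by move=> s; exact: IC0.
      - exact: mC.
      - move=> s; rewrite /I/= in_itv/= => /andP[s1 _].
        by rewrite lee_fin; exact: CN.
    rewrite integral_cst; last exact: mI.
    by rewrite [X in (_ * X)%E](lI j) -EFinM mulrC.
  by rewrite sumEFin lee_fin big_mkord -mulr_sumr ler_wpM2l.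
- rewrite -cover; apply: mC => //; exact: measurable_itv.
- by move=> s; rewrite -cover/= in_itv/= andbT lee_fin; exact: C0.
- apply/trivIsetP => i j _ _ ij; apply/seteqP; split=> // s [].
  rewrite /I/= !in_itv/= => /andP[a1 a2] /andP[b1 b2].
  have := le_lt_trans a1 b2; have := le_lt_trans b1 a2.
  rewrite !ltr_nat !ltn_pmul2l// !ltnS => ji ij'.
  by move: ij; rewrite eqn_leq ji ij'.
Qed.

(** A Dini-type argument. Positivity at [x] spreads to a neighbourhood by continuity and to later
    indices by monotonicity. Using the level [1 / (n + 1)] ties the lower bound to the index, so
    compactness has a single eventual property in [n] to make uniform. *)
Lemma compact_unif_pos (R : realType) (E : topologicalType)
    (u : nat -> E -> R) : compact [set: E] ->
  (forall n, continuous (u n)) ->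
  (forall m n x, (m <= n)%N -> u m x <= u n x) ->
  (forall x, exists n, 0 < u n x) ->
  exists n, exists2 c, 0 < c & forall x, c <= u n x.
Proof.
move=> cE cu und upos.
have : \forall n \near \oo, [set: E] `<=` (fun x => n.+1%:R^-1 <= u n x).
  apply: ((compact_near_coveringP _).1 cE nat \oo
    (fun n x => n.+1%:R^-1 <= u n x)) => x _.
  have [N uN] := upos x; pose a := u N x / 2.
  have a0 : 0 < a by rewrite divr_gt0.
  have au : a < u N x by rewrite /a; lra.
  exists ([set y | a < u N y],
      [set n | (N + (Num.truncn a^-1) <= n)%N]) => /=.
    split; last exact: nbhs_infty_ge.
    by apply: (cvgr_gt _ (cu N x)).
  move=> [y n]/= [ay Nn]; apply: (@le_trans _ _ a).
    rewrite -[leRHS]invrK lef_pV2 ?posrE ?invr_gt0//.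
    rewrite (le_trans (ltW (truncnS_gt _)))// ler_nat ltnS.
    by rewrite (leq_trans _ Nn)// leq_addl.
  by rewrite (le_trans (ltW ay))// und// (leq_trans _ Nn)// leq_addr.
move=> [n _ /(_ n (leqnn n)) h]; exists n, n.+1%:R^-1.
  by rewrite invr_gt0.
by move=> x; exact: h.
Qed.

(** * Sub-Markovian kernels *)

Section kernel_operator.
Context d (T : measurableType d) (R : realType).
Implicit Types (K : R.-spker T ~> T) (f : T -> R).

Definition kop K f (x : T) : R := \int[K x]_y f y.

Lemma spker_fin K x : (K x setT < +oo)%E.
Proof. by rewrite (le_lt_trans (sprob_kernel_le1 K x))// ltry. Qed.

Lemma EFin_Rintegral (mu : {measure set T -> \bar R}) f :
  (mu setT < +oo)%E -> bm f ->
  (\int[mu]_x (f x)%:E = (\int[mu]_x f x)%R%:E)%E.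
Proof.
move=> mufin bf; rewrite /Rintegral fineK//.
by apply: integrable_fin_num => //; exact: bm_integrable.
Qed.

Lemma plf_kop K x : plf (kop K ^~ x).
Proof. by apply: plf_Rintegral; exact: spker_fin. Qed.

Lemma kop_indic K A x : measurable A -> (kop K \1_A x)%:E = K x A.
Proof.
move=> mA; rewrite /kop Rintegral_indic// fineK//.
rewrite ge0_fin_numE// (le_lt_trans _ (spker_fin K x))//.
by apply: le_measure; rewrite ?inE.
Qed.

Lemma kop1 K x : (kop K (fun=> 1) x)%:E = K x setT.
Proof. by rewrite -kop_indic// indicT. Qed.

Lemma kop1_le K x : kop K (fun=> 1) x <= 1.
Proof. by rewrite -lee_fin kop1 sprob_kernel_le1. Qed.

Lemma bm_kop K f : bm f -> bm (kop K f).
Proof.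
move=> bf; have [c c0 fc] := bm_ub bf.
have f0 x : 0 <= f x + c by have := fc x; rewrite ler_norml => /andP[]; lra.
have pos g : bm g -> (forall x, 0 <= g x) -> measurable_fun setT (kop K g).
  move=> bg g0.
  apply: (@measurableT_comp _ _ _ _ _ _ fine _ (fun x => \int[K x]_y (g y)%:E)%E).
    exact: fine_measurable.
  apply: (measurable_fun_integral_kernel (fun U => measurable_kernel K U)).
    by move=> y; rewrite lee_fin.
  by apply/measurable_EFinP; case: bg.
(* Adding the bound [c] makes the integrand nonnegative, the case treated by [pos]. *)
have -> : kop K f =
    (fun x => kop K (fun y => f y + c) x - kop K (fun=> c) x).
  apply/funext => x; rewrite (linD (plf_kop K x).1) ?addrK//.
  exact: bm_cst.
split.
  apply: measurable_funB; apply: pos => //; first exact: (bmD bf (bm_cst c)).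
  exact: bm_cst.
exists c => x; rewrite -(linB (plf_kop K x).1); last exact: bm_cst.
  apply: (@le_trans _ _ (c * kop K (fun=> 1) x)).
    apply: (plf_norm_le (plf_kop K x)) => [|y]; last by rewrite addrK.
    by under [X in bm X]eq_fun do rewrite addrK.
  by rewrite ler_piMr// kop1_le.
exact: (bmD bf (bm_cst c)).
Qed.

Lemma pop_kop K : pop (kop K).
Proof. by split; [exact: bm_kop|exact: plf_kop]. Qed.

Lemma kop_kiter K n f x : bm f -> kop (kiter K n) f x = iter n (kop K) f x.
Proof.
move=> bf; elim: n f bf x => [|n IH] f bf x.
  rewrite /kop /Rintegral/= integral_dirac//.
    by rewrite diracT mul1e.
  by apply/measurable_EFinP; case: bf.
move: f bf; apply: plf_ext.
- exact/plf_blf/plf_kop.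
- apply: (@plf_blf _ _ _ ((iter n.+1 (kop K)) ^~ x)).
  exact: (pop_iter n.+1 (pop_kop K)).2.
- move=> A mA; apply/EFin_inj; rewrite kop_indic//.
  rewrite iterSr -IH; last exact/bm_kop/bm_indic.
  rewrite /= /mkcomp_noparam /= /kcomp_noparam.
  rewrite -EFin_Rintegral; [|exact: spker_fin|exact/bm_kop/bm_indic].
  by apply: eq_integral => y _; rewrite kop_indic.
Qed.

Lemma kiterE K n x A : measurable A ->
  kiter K n x A = (iter n (kop K) \1_A x)%:E.
Proof. by move=> mA; rewrite -kop_kiter ?kop_indic//; exact: bm_indic. Qed.

Lemma kiter_setT K n x : kiter K n x setT = (iter n (kop K) (fun=> 1) x)%:E.
Proof. by rewrite kiterE// indicT. Qed.

Lemma killE K x : kill K x = (1 - kop K (fun=> 1) x)%:E.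
Proof. by rewrite /kill -kop1. Qed.

Lemma Rintegral_qsd K (mu : probability T R) : is_qsd K mu ->
  forall f, bm f -> \int[mu]_x kop K f x =
    (\int[mu]_x kop K (fun=> 1) x) * \int[mu]_x f x.
Proof.
move=> qsd; have mufin : (mu setT < +oo)%E by rewrite probability_setT ltry.
have muK A : measurable A ->
    (\int[mu]_x K x A = (\int[mu]_x kop K \1_A x)%R%:E)%E.
  move=> mA; rewrite -EFin_Rintegral//; last exact/bm_kop/bm_indic.
  by apply: eq_integral => y _; rewrite kop_indic.
pose lam : R := \int[mu]_x kop K (fun=> 1) x.
have muKT : (\int[mu]_x K x setT = lam%:E)%E by rewrite muK// indicT.
(* Were [lam] zero, the equation on the whole space would read [1 = 0 / 0], and this quotient is 0
   because its numerator is. *)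
have lam0 : lam != 0.
  apply/eqP => l0; have := qsd setT measurableT.
  by rewrite muKT l0 mul0e probability_setT => /eqP; rewrite onee_eq0.
move=> f; rewrite -/lam; move: f; apply: plf_ext.
- exact/plf_blf/(plf_pop (plf_Rintegral mufin) (pop_kop K)).
- have pmu := plf_Rintegral mufin; split=> [a f g bf bg|].
    by rewrite pmu.1//; ring.
  have [C CP] := (plf_blf pmu).2; exists (`|lam| * C) => f c bf fc.
  by rewrite normrM -mulrA ler_wpM2l//; exact: CP.
- move=> A mA; rewrite Rintegral_indic//; have := qsd A mA.
  rewrite muK// muKT inver (negbTE lam0) -EFinM.
  move=> /(congr1 fine)/= E; apply: (@etrans _ _ (lam * fine (mu A))); last by [].
  by rewrite E mulrCA mulfV// mulr1.
Qed.

End kernel_operator.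

Section cemetery.
Context d (T : measurableType d) (R : realType) (K : R.-spker T ~> T).

Let KB : R.-spker (option T) ~> option T := kbar K.

Let mSome : measurable_fun [set: T] (@Some T).
Proof. by move=> _ A mA; rewrite setTI. Qed.

Let kop_kbar_Some (F : option T -> R) x : bm F ->
  kop KB F (Some x) =
  kop K (F \o Some) x + (1 - kop K (fun=> 1) x) * F None.
Proof.
move: F; apply: plf_ext.
- exact/plf_blf/plf_kop.
- apply: plf_blf; split=> [a f g bf bg|f bf f0].
    rewrite -[kop K (_ \o _) x]/(kop K (fun y => a * f (Some y) + g (Some y)) x).
    rewrite (plf_kop K x).1; [by ring|exact: (bm_comp mSome bf)|].
    exact: (bm_comp mSome bg).
  apply: addr_ge0.
    apply: (plf_kop K x).2; first exact: (bm_comp mSome bf).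
    by move=> y; exact: f0.
  by rewrite mulr_ge0// subr_ge0 kop1_le.
- move=> A mA; apply/EFin_inj; rewrite kop_indic//= /kbar_fun.
  rewrite [RHS]EFinD [X in _ = (_ + X)%E]EFinM killE diracE.
  rewrite -[kop K (_ \o _) x]/(kop K \1_(Some @^-1` A) x).
  by rewrite kop_indic.
Qed.

Let kop_kbar_None (F : option T -> R) : bm F -> kop KB F None = F None.
Proof.
move: F; apply: plf_ext.
- exact/plf_blf/plf_kop.
- by apply: plf_blf; split.
- by move=> A mA; apply/EFin_inj; rewrite kop_indic//= diracE.
Qed.

(** Absorption by time [n] is the complement of survival. The accessibility of the cemetery thus
    becomes a statement on the functions [K^n 1] alone. *)
Lemma kiter_kbar_None n x :
  kiter (kbar K) n (Some x) [set None] = (1 - iter n (kop K) (fun=> 1) x)%:E.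
Proof.
have mN : measurable [set (None : option T)].
  rewrite /measurable/= /option_measurable/=.
  by rewrite (_ : _ @^-1` _ = set0)// -subset0 => y.
rewrite (@kiterE _ _ _ KB)//; congr (_%:E).
set F : option T -> R := \1_[set None].
have bF m : bm (iter m (kop KB) F) by apply: bm_iter; [exact: pop_kop|exact: bm_indic].
have FN m : iter m (kop KB) F None = 1.
  elim: m => [|m IH]; first by rewrite /= /F indicE mem_set.
  by rewrite iterS kop_kbar_None.
elim: n x => [|n IH] x; first by rewrite /= /F indicE memNset ?subrr.
rewrite iterS kop_kbar_Some// FN mulr1.
rewrite (_ : _ \o _ = fun y => 1 - iter n (kop K) (fun=> 1) y).
  rewrite (linB (plf_kop K x).1).
  - by rewrite iterS; ring.
  - exact: bm_cst.
  - by apply: bm_iter; [exact: pop_kop|exact: bm_cst].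
by apply/funext => y; exact: IH.
Qed.

End cemetery.

(** * Feller kernels on a compact metric space *)

Section compact_metric.
Context (R : realType) (E : pmetricType R).
Hypothesis cE : compact [set: E].
Implicit Types f : E -> R.

Lemma continuous_bm f : continuous f -> bm (f : borel E -> R).
Proof.
move=> cf; split.
  apply: (measurability (@RGenOInfty.G R)) => [|/= _ [_] [r] -> <-].
    exact: RGenOInfty.measurableE.
  rewrite setTI; apply: sub_sigma_algebra.
  by apply: open_comp => //; exact: interval_open.
(* Boundedness on a compact space as uniform positivity of [n - |f|] for some [n]. *)
have [n [c c0 h]] : exists n, exists2 c : R, 0 < c &
    forall x, c <= n%:R - `|f x|.
  apply: (@compact_unif_pos R E (fun n x => n%:R - `|f x|)) => //.
  - by move=> n x; apply: cvgB; [exact: cvg_cst|apply: cvg_norm; exact: cf].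
  - by move=> m n x mn; rewrite lerD2r ler_nat.
  - move=> x; exists (Num.truncn `|f x|).+1.
    by rewrite subr_gt0 truncnS_gt.
by exists n%:R => x; have := h x; lra.
Qed.

(** The distance to the complement of [U], capped at 1. It stands in for the indicator of [U], whose
    images under a Feller kernel need not be continuous. An empty complement is at infinite
    distance, so the constant 1 is taken there. *)
Lemma open_continuous_pos (U : set E) : open U -> exists f : E -> R,
  [/\ continuous f, forall x, 0 <= f x <= 1, forall x, U x -> 0 < f x &
      forall x, ~ U x -> f x = 0].
Proof.
move=> oU; have [UT|/set0P[a Ua]] := eqVneq (~` U) set0.
  exists (fun=> 1); split => //.
  - by move=> x; exact: cvg_cst.
  - by move=> x; rewrite ler01 lexx.
  - by move=> x Ux; have : (~` U) x by []; rewrite UT.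
have dfin x : edist_inf (~` U) x \is a fin_num.
  rewrite ge0_fin_numE ?edist_inf_ge0 //; apply: (@le_lt_trans _ _ (edist (x, a))).
    by apply: ereal_inf_lbound; exists a.
  rewrite -ge0_fin_numE ?edist_ge0 //; apply/edist_finP => /=.
  exists (mdist x a + 1); first by rewrite ltr_wpDl// mdist_ge0.
  by rewrite ballEmdist/= ltrDl.
exists (fun x => Num.min (fine (edist_inf (~` U) x)) 1); split.
- move=> x; apply: (@continuous_min R E (fun z => fine (edist_inf (~` U) z)) (fun=> 1)).
    apply: fine_cvg; rewrite fineK //; exact: edist_inf_continuous.
  exact: cvg_cst.
- move=> x; rewrite le_min ler01 andbT fine_ge0 ?edist_inf_ge0//=.
  by rewrite ge_min lexx orbT.
- move=> x Ux; rewrite lt_min ltr01 andbT fine_gt0// ltey_eq dfin andbT.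
  have /nbhs_ballP[e /= e0 xU] : nbhs x U by exact: open_nbhs_nbhs.
  apply: (@lt_le_trans _ _ e%:E); first by rewrite lte_fin.
  apply: le_ereal_inf_tmp => _ [z /= zU <-]; rewrite leNgt; apply/negP.
  by move=> /edist_lt_ball/= /xU.
- by move=> x Ux; rewrite edist_inf0// fine0 min_l.
Qed.

Variable K : R.-spker (borel E) ~> (borel E).
Hypothesis fK : feller K.

Lemma continuous_iter_kop n f : continuous f ->
  continuous (iter n (kop K) f : E -> R).
Proof. by move=> cf; elim: n => // n IH; exact: fK. Qed.

(** Each point has a positive chance of absorption, the chance grows with time, and compactness
    gives one time [N] and one level [c] for all points; iterating over blocks of length [N'] gives
    the geometric rate. *)
Lemma iter_kop_geometric : cemetery_accessible K ->
  exists D t, [/\ 0 < t, t < 1 &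
    forall n x, iter n (kop K) (fun=> 1) x <= D * t ^+ n].
Proof.
move=> acc.
have it_le m n x : (m <= n)%N ->
    iter n (kop K) (fun=> 1) x <= iter m (kop K) (fun=> 1) x.
  move=> /subnKC <-; rewrite iterD.
  apply: (plf_le ((pop_iter m (pop_kop K)).2 x)).
  - by apply: bm_iter; [exact: pop_kop|exact: bm_cst].
  - exact: bm_cst.
  elim: (n - m)%N => // k IH y; rewrite iterS (le_trans _ (kop1_le K y))//.
  apply: (plf_le (plf_kop K y)) => //; last exact: bm_cst.
  by apply: bm_iter; [exact: pop_kop|exact: bm_cst].
have [N [c c0 cN]] : exists n, exists2 c : R, 0 < c &
    forall x, c <= 1 - iter n (kop K) (fun=> 1) x.
  apply: (@compact_unif_pos R E (fun n x => 1 - iter n (kop K) (fun=> 1) x)) => //.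
  - move=> n x; apply: cvgB; first exact: cvg_cst.
    by apply: continuous_iter_kop => ?; exact: cvg_cst.
  - by move=> m n x mn; rewrite lerB// it_le.
  - move=> x; apply: contrapT => /forallNP h.
    have := acc x; rewrite eseries0 ?ltxx// => n _ _.
    rewrite kiter_kbar_None; congr (_%:E).
    have := it_le 0%N n x (leq0n n); have : 1 - iter n (kop K) (fun=> 1) x <= 0.
      by rewrite leNgt; apply/negP/h.
    by move=> /=; lra.
(* The successor makes the block length nonzero, and the cap at 1/2 keeps [rho] positive. *)
pose N' := N.+1; pose rho := 1 - Num.min c 2^-1.
have rho0 : 0 < rho by rewrite subr_gt0 gt_min; apply/orP; right; lra.
have rho1 : rho < 1 by rewrite gtrBl lt_min c0/=; lra.
have KN x : iter N' (kop K) (fun=> 1) x <= rho.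
  rewrite (le_trans (it_le N _ x _))//; have := cN x.
  have : Num.min c 2^-1 <= c by rewrite ge_min lexx.
  by rewrite /rho; lra.
(* By Bernoulli's inequality [t ^+ N' >= rho], so no [N']-th root is needed. *)
pose t := 1 - (1 - rho) / N'%:R.
have N1 : 1 <= N'%:R :> R by rewrite ler1n.
have N0 : 0 < N'%:R :> R by rewrite ltr0n.
have t1 : t < 1 by rewrite gtrBl divr_gt0// subr_gt0.
have t0 : 0 < t.
  by rewrite subr_gt0 ltr_pdivrMr// mul1r (lt_le_trans _ N1)//; lra.
have rhot : rho <= t ^+ N'.
  have bern k : 1 - k%:R * ((1 - rho) / N'%:R) <= t ^+ k.
    elim: k => [|k IH]; first by rewrite mul0r subr0 expr0.
    rewrite exprS; apply: (le_trans _ (ler_wpM2l (ltW t0) IH)).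
    rewrite -natr1 /t; set a := (1 - rho) / _.
    have a0 : 0 <= a by rewrite divr_ge0//; lra.
    by have := ler0n R k; nra.
  by have := bern N'; rewrite mulrC divfK ?lt0r_neq0// opprB addrC subrK.
(* The constant absorbs an incomplete block: for [n < N'] one has [K^n 1 <= 1 <= t^n / t^N']. *)
exists (t ^+ N')^-1, t; split => //; elim/ltn_ind => n IH x.
have tN : 0 < t ^+ N' by rewrite exprn_gt0.
have [nN|Nn] := ltnP n N'.
  rewrite (@le_trans _ _ 1)//; first exact: (it_le 0%N).
  rewrite mulrC ler_pdivlMr// mul1r; apply: ler_wiXn2l; rewrite ?(ltW t0) ?(ltW t1)//.
  exact: ltnW.
rewrite -(subnK Nn) iterD exprD.
have bK : bm (iter N' (kop K) (fun=> 1 : R)).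
  by apply: bm_iter; [exact: pop_kop|exact: bm_cst].
apply: (@le_trans _ _ (iter (n - N') (kop K) (fun=> rho) x)).
  by apply: (plf_le ((pop_iter _ (pop_kop K)).2 x)) => //; exact: bm_cst.
rewrite (lin_cst ((pop_iter _ (pop_kop K)).2 x).1).
rewrite [_ * t ^+ N']mulrC mulrCA ler_pM ?(ltW rho0)//.
  by apply: pop_ge0; [exact/pop_iter/pop_kop|exact: bm_cst|].
by apply: IH; rewrite ltn_subrL/= (leq_trans _ Nn).
Qed.

(** The inner potential uses smallness, [A f >= eps * Psi f] on [U], hence [A f >= eps * Psi f * g]
    everywhere for a continuous [g] with values in [[0, 1]], positive exactly on [U]. The outer one
    uses accessibility: [A g] is bounded below by compactness. *)
Lemma small_set_minorization (D t : R) (U : set E)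
    (Psi : probability (borel E) R) (eps : R) : 0 < t -> t < 1 ->
  (forall n x, iter n (kop K) (fun=> 1) x <= D * t ^+ n) ->
  open U -> accessible K U -> 0 < eps -> weak_small K U Psi eps ->
  exists2 c : R, 0 < c &
    forall (f : borel E -> R) x, bm f -> (forall y, 0 <= f y) ->
    c * \int[Psi]_y f y <= potential (kop K) (potential (kop K) f) x.
Proof.
move=> t0 t1 geo oU accU eps0 small.
have pQ := pop_kop K; have pA := pop_potential pQ t0 t1 geo.
set A := potential (kop K) in pA *.
have pPsi : plf (fun f : borel E -> R => \int[Psi]_y f y).
  have Psifin : (Psi setT < +oo)%E by rewrite probability_setT ltry.
  exact: plf_Rintegral.
have mU : measurable (U : set (borel E)) by exact: sub_sigma_algebra.
have AU x (f : borel E -> R) : U x -> bm f -> (forall y, 0 <= f y) ->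
    eps * \int[Psi]_y f y <= A f x.
  move=> Ux bf f0; rewrite -subr_ge0; move: f bf f0.
  apply: blf_ge0.
    apply: blfB; first exact: plf_blf (pA.2 x).
    apply: plf_blf; split=> [a f g bf bg|f bf f0].
      by rewrite pPsi.1//; ring.
    by rewrite mulr_ge0 ?(ltW eps0)//; exact: pPsi.2.
  move=> B mB; rewrite subr_ge0 -lee_fin EFinM.
  rewrite Rintegral_indic// fineK ?fin_num_measure//.
  apply: (le_trans (small x Ux B mB)); apply: lime_le.
    by apply: is_cvg_nneseries => n _ _; exact: measure_ge0.
  apply: nearW => n.
  under eq_bigr do rewrite kiterE//.
  rewrite sumEFin lee_fin.
  (* The series in [weak_small] starts at 1, the potential at 0; the extra term is nonnegative. *)
  apply: (le_trans _ (@potential_psum_ge _ _ _ _ _ _ pQ t0 t1 geo \1_B n x _ _)).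
  - rewrite -(big_mkord xpredT (fun i => iter i (kop K) \1_B x)).
    case: n => [|n]; first by rewrite !big_geq.
    rewrite [leRHS]big_ltn// lerDr; exact: ler0n.
  - exact: bm_indic.
  - by move=> y; exact: ler0n.
have [g [cg g01 gU gN]] := open_continuous_pos oU.
have bg := continuous_bm cg.
have g0 y : 0 <= g y by have /andP[] := g01 y.
have it_ge0 n x : 0 <= iter n (kop K) g x.
  exact: (pop_ge0 x (pop_iter n pQ) bg g0).
have [N [c c0 cN]] : exists n, exists2 c : R, 0 < c &
    forall x, c <= \sum_(i < n) iter i (kop K) g x.
  apply: (@compact_unif_pos R E (fun n x => \sum_(i < n) iter i (kop K) g x)) => //.
  - move=> n; elim: n => [|n IH] /=.
      rewrite (_ : (fun x => _) = fun=> 0); first by move=> x; exact: cvg_cst.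
      by apply/funext => x; rewrite big_ord0.
    rewrite (_ : (fun x => _) = fun x =>
      \sum_(i < n) iter i (kop K) g x + iter n (kop K) g x).
      by move=> x; apply: cvgD; [exact: IH|exact: continuous_iter_kop].
    by apply/funext => x; rewrite big_ord_recr.
  - move=> m n x mn; rewrite -(subnKC mn) big_split_ord/= lerDl.
    exact: sumr_ge0.
  - move=> x; apply: contrapT => /forallNP h.
    have := accU x; rewrite eseries0 ?ltxx// => n _ _.
    have gn0 : iter n (kop K) g x = 0.
      apply/eqP; rewrite eq_le it_ge0 andbT leNgt; apply/negP => gn.
      apply: (h n.+1); rewrite big_ord_recr/=.
      by rewrite ltr_wpDl// sumr_ge0.
    (* If [K^n g] vanishes at [x], then [g] is zero almost everywhere for [K^n(x, .)]; as [g > 0] on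
       [U], this measure does not charge [U]. *)
    have /(ae_eq_integral_abs _ measurableT _).1 :
        (\int[kiter K n x]_y `|(g y)%:E| = 0)%E.
      under eq_integral do rewrite gee0_abs ?lee_fin//.
      rewrite EFin_Rintegral//; last exact: spker_fin.
      by congr (_%:E); rewrite -gn0 -kop_kiter.
    move=> /(_ _)[|Z [mZ Z0 UZ]].
      by apply/measurable_EFinP; case: bg.
    apply/eqP; rewrite eq_le measure_ge0 andbT -Z0.
    apply: le_measure; rewrite ?inE// => y Uy; apply: UZ => /= /(_ Logic.I) [].
    by apply/eqP; rewrite gt_eqF// gU.
exists (eps * c); first exact: mulr_gt0.
move=> f x bf f0; have If : 0 <= \int[Psi]_y f y by exact: pPsi.2.
apply: (@le_trans _ _ (A (fun y => (eps * \int[Psi]_y f y) * g y) x)).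
  rewrite (linZ (pA.2 x).1)// mulrAC ler_wpM2l ?mulr_ge0 ?(ltW eps0)//.
  apply: (le_trans (cN x)).
  exact: (potential_psum_ge pQ t0 t1 geo).
apply: (plf_le (pA.2 x)); [exact: bmZ|exact: pA.1|move=> y].
have [Uy|Uy] := pselect (U y).
  apply: le_trans (AU y f Uy bf f0).
  by rewrite ler_piMr ?mulr_ge0 ?(ltW eps0)//; have /andP[] := g01 y.
by rewrite gN// mulr0; exact: pop_ge0.
Qed.

End compact_metric.

(** * Step sizes *)

Section step_size_averages.
Context (R : realType) (eta : nat -> R).
Hypothesis eta_gt0 : forall n, 0 < eta n.
Hypothesis gamma_noninc : nonincreasing_seq (gamma eta).

Definition step_sum (n : nat) : R := \sum_(k < n.+1) eta k.

Local Notation S := step_sum.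
Local Notation g := (gamma eta).

Lemma step_sum_gt0 n : 0 < S n.
Proof.
rewrite /S big_ord_recr/= ltr_wpDl// sumr_ge0// => k _; exact: ltW.
Qed.

Lemma step_sumS n : S n.+1 = S n + eta n.+1.
Proof. by rewrite /S big_ord_recr. Qed.

Lemma step_sum_le m n : (m <= n)%N -> S m <= S n.
Proof.
elim: n => [|n IH]; first by rewrite leqn0 => /eqP ->.
rewrite leq_eqVlt => /predU1P[->//|/IH h].
by rewrite step_sumS (le_trans h)// lerDl ltW.
Qed.

Lemma gamma_ge0 n : 0 <= g n.
Proof. by rewrite /gamma divr_ge0 ?(ltW (step_sum_gt0 n))// ltW. Qed.

Lemma eta_gamma n : eta n = g n * S n.
Proof. by rewrite /gamma divfK// lt0r_neq0// step_sum_gt0. Qed.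

(** Summation by parts leaves the increments of [eta]. Monotonicity of [gamma] bounds them from
    above by [gamma * eta] at the later index, and a number [x <= p] with [p >= 0] satisfies
    [|x| <= 2 p - x], so the net increase of [eta] is subtracted from the total variation. *)
Lemma abel_step_bound (h : nat -> R) c n : (forall k, `|h k| <= c) ->
  `|\sum_(k < n.+1) eta k * (h k - h k.+1)| <=
  2 * c * \sum_(k < n.+1) g k * eta k.
Proof.
move=> hc; have c0 : 0 <= c by exact: le_trans (hc 0%N).
(* The boundary term is kept inside the norm; the surplus [- eta n] on the right pays for removing
   it at the end. *)
have key : `|\sum_(k < n.+1) eta k * (h k - h k.+1) + eta n * h n.+1| <=
    c * (2 * (\sum_(k < n.+1) g k * eta k) - eta n).
  elim: n => [|n IH].
    rewrite !big_ord1 mulrBr subrK normrM gtr0_norm// mulrC.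
    have -> : g 0%N = 1 by rewrite /gamma big_ord1 divff// lt0r_neq0.
    by rewrite mul1r ler_pM//; [exact: ltW|lra].
  rewrite [X in `|X + _|]big_ord_recr [X in 2 * X]big_ord_recr/=.
  set s1 := \sum_(k < n.+1) _ in IH *; set s2 := \sum_(k < n.+1) _ in IH *.
  have -> : s1 + eta n.+1 * (h n.+1 - h n.+2) + eta n.+1 * h n.+2 =
    (s1 + eta n * h n.+1) + (eta n.+1 - eta n) * h n.+1 by ring.
  rewrite (le_trans (ler_normD _ _))//.
  have -> : c * (2 * (s2 + g n.+1 * eta n.+1) - eta n.+1) =
    c * (2 * s2 - eta n) + c * (2 * (g n.+1 * eta n.+1) - (eta n.+1 - eta n)).
    by ring.
  rewrite lerD// normrM mulrC.
  have d1 : eta n.+1 - eta n <= g n.+1 * eta n.+1.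
    rewrite [in X in X - _]eta_gamma [in X in _ - X]eta_gamma step_sumS mulrDr.
    have := gamma_noninc (leqnSn n); have := step_sum_gt0 n.
    by move: (g n) (g n.+1) (S n) => a b s s0 ab; nra.
  have d2 := mulr_ge0 (gamma_ge0 n.+1) (ltW (eta_gt0 n.+1)).
  by rewrite ler_pM// ler_norml; apply/andP; split; lra.
have -> : \sum_(k < n.+1) eta k * (h k - h k.+1) =
  (\sum_(k < n.+1) eta k * (h k - h k.+1) + eta n * h n.+1) - eta n * h n.+1.
  by rewrite addrK.
rewrite (le_trans (ler_normB _ _))//.
have -> : 2 * c * \sum_(k < n.+1) g k * eta k =
  c * (2 * (\sum_(k < n.+1) g k * eta k) - eta n) + eta n * c by ring.
by rewrite lerD// normrM gtr0_norm// ler_pM2l.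
Qed.

Lemma eta_sq_sum_le n : \sum_(k < n.+1) eta k ^+ 2 <=
  S n * \sum_(k < n.+1) g k * eta k.
Proof.
rewrite mulr_sumr; apply: ler_sum => k _.
rewrite expr2 {1}eta_gamma mulrAC [leRHS]mulrC ler_wpM2l//.
  by rewrite mulr_ge0 ?gamma_ge0// ltW.
by rewrite step_sum_le// -ltnS.
Qed.

Hypothesis gamma_sum : (\sum_(0 <= n <oo) (gamma eta n)%:E = +oo)%E.

(** Since [gamma k <= eta k / eta 0], bounded sums of [eta] would make the sum of [gamma] finite. *)
Lemma step_sum_unbounded (H : R) : exists N, forall n, (N <= n)%N -> H <= S n.
Proof.
suff [N HN] : exists N, H <= S N.
  by exists N => n Nn; rewrite (le_trans HN)// step_sum_le.
apply: contrapT => /forallNP h.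
have {}h n : S n <= H by rewrite leNgt; apply/negP => Hn; apply: (h n); exact: ltW.
suff : (\sum_(0 <= n <oo) (gamma eta n)%:E <= (H / eta 0%N)%:E)%E.
  by rewrite gamma_sum leNgt ltry.
apply: lime_le; first by apply: is_cvg_nneseries => n _ _; rewrite lee_fin gamma_ge0.
apply: nearW => n; rewrite sumEFin lee_fin big_mkord.
have e0 := eta_gt0 0%N.
apply: (@le_trans _ _ (\sum_(k < n) eta k / eta 0%N)).
  apply: ler_sum => k _; rewrite /gamma ler_wpM2l ?(ltW (eta_gt0 _))//.
  rewrite lef_pV2 ?posrE//; last exact: step_sum_gt0.
  by have := step_sum_le (leq0n k); rewrite /S big_ord1.
rewrite -mulr_suml ler_wpM2r ?invr_ge0 ?(ltW e0)// (le_trans _ (h n))//.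
by rewrite /S big_ord_recr/= lerDl ltW.
Qed.

Lemma weighted_average_cvg0 (u : nat -> R) : u n @[n --> \oo] --> 0 ->
  (\sum_(k < n.+1) eta k * u k) / S n @[n --> \oo] --> 0.
Proof.
move=> u0; apply/cvgrPdist_le => e e0.
have e2 : 0 < e / 2 by rewrite divr_gt0.
move/cvgrPdist_le : u0 => /(_ _ e2)[N _ uN].
have {}uN k : (N <= k)%N -> `|u k| <= e / 2.
  by move=> /uN /=; rewrite sub0r normrN.
(* The excess over [e / 2] vanishes from [N] on, so its weighted sum stays below the constant [H],
   which is negligible against [S n]. *)
pose a k := Num.max 0 (`|u k| - e / 2).
have a0 k : 0 <= eta k * a k by rewrite mulr_ge0 ?(ltW (eta_gt0 _))// le_max lexx.
pose H := \sum_(k < N) eta k * a k.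
have aH n : \sum_(k < n) eta k * a k <= H.
  rewrite /H; case: (leqP n N) => [nN|/ltnW Nn].
    by rewrite -(subnKC nN) big_split_ord/= lerDl sumr_ge0.
  rewrite -(subnKC Nn) big_split_ord/= gerDl le_eqVlt big1 ?eqxx// => k _.
  rewrite /a max_l ?mulr0//; have := uN (N + k)%N (leq_addr _ _); lra.
have [M SM] := step_sum_unbounded (2 * H / e).
exists M => // n /= /SM Sn; rewrite sub0r normrN.
have S0 := step_sum_gt0 n.
rewrite normrM normfV [`|S n|]gtr0_norm// ler_pdivrMr//.
apply: (@le_trans _ _ (\sum_(k < n.+1) (eta k * a k + e / 2 * eta k))).
  rewrite (le_trans (ler_norm_sum _ _ _))//; apply: ler_sum => k _.
  rewrite normrM gtr0_norm// [e / 2 * _]mulrC -mulrDr ler_pM2l//.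
  by rewrite -lerBlDr /a le_max lexx orbT.
rewrite big_split/= -mulr_sumr; apply: (le_trans (lerD (aH _) (lexx _))).
have : H <= e / 2 * S n.
  by move: Sn; rewrite ler_pdivrMr//; lra.
by rewrite /S; lra.
Qed.

End step_size_averages.

Lemma gamma_cvg0 (R : realType) (eta : nat -> R) : (forall n, 0 < eta n) ->
  (gamma eta n * ln n%:R) @[n --> \oo] --> 0 -> gamma eta n @[n --> \oo] --> 0.
Proof.
move=> eta0 h.
apply: (squeeze_cvgr (f := fun=> 0) (h := fun n => gamma eta n * ln n%:R)) => //;
  last exact: cvg_cst.
(* Beyond [expR 1] the logarithm is at least 1, so [gamma eta n] lies below [gamma eta n * ln n]. *)
exists (Num.truncn (expR 1 : R)).+1 => // n /= nN; rewrite gamma_ge0//=.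
have en : expR 1 <= n%:R :> R.
  by rewrite (le_trans (ltW (truncnS_gt _)))// ler_nat.
rewrite ler_peMr ?gamma_ge0// -[leLHS]expRK ler_ln ?posrE ?expR_gt0//.
apply: (lt_le_trans _ en); exact: expR_gt0.
Qed.

(** * The process with return *)

Section process.
Context d (T : measurableType d) (R : realType) (K : R.-spker T ~> T).
Variable eta : nat -> R.
Hypothesis eta_gt0 : forall n, 0 < eta n.
Context (d' : measure_display) (Omega : measurableType d').
Variables (P : probability Omega R) (F : nat -> set (set Omega)).
Hypothesis filtF : filtration F.
Variable X : nat -> {RV P >-> T}.
Hypothesis adX : adapted F (fun n => X n : Omega -> T).
Hypothesis X_trans : forall n (A : set T), measurable A ->
  cond_prob P (F n) (X n.+1 @^-1` A)
    (fun w => kreturn K (occupation eta (fun k => X k w) n) (X n w) A).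

Implicit Types (f h : T -> R) (Z : Omega -> R) (w : Omega).

Local Notation S := (step_sum eta).

(** The integral of [f] against the occupation measure [mu_n] of the path [w]. *)
Definition occ n f w : R := (\sum_(k < n.+1) eta k * f (X k w)) / S n.

Definition expect Z : R := \int[P]_w Z w.

Local Notation survival w n := (kop K (fun=> 1) (X n w)).

(* A version of the conditional expectation of [h (X n.+1)] given [F n]. *)
Definition next_mean h n w : R :=
  kop K h (X n w) + (1 - survival w n) * occ n h w.

Let plf_expect : plf expect.
Proof.
have Pfin : (P setT < +oo)%E by rewrite probability_setT ltry.
exact: plf_Rintegral.
Qed.

Let expect1 : expect (fun=> 1) = 1.
Proof.
have P1 : fine (P setT) = 1 by rewrite probability_setT.
by rewrite /expect Rintegral_cst// mul1r; exact: P1.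
Qed.

Lemma bm_RV n f : bm f -> bm (fun w => f (X n w)).
Proof. by apply: bm_comp; exact: measurable_funPT. Qed.

Lemma bm_occ n f : bm f -> bm (occ n f).
Proof.
move=> bf; rewrite /occ; under [X in bm X]eq_fun do rewrite mulrC.
by apply: bmZ; apply: bm_sum => k; apply: bmZ; exact: bm_RV.
Qed.

Lemma bm_survival n : bm (fun w => 1 - survival w n).
Proof.
apply: bmB; first exact: bm_cst.
by apply: (@bm_RV n (kop K (fun=> 1))); apply: bm_kop; exact: bm_cst.
Qed.

Lemma bm_next_mean n h : bm h -> bm (next_mean h n).
Proof.
move=> bh; apply: bmD; first by apply: (@bm_RV n (kop K h)); exact: bm_kop.
by apply: bmM; [exact: bm_survival|exact: bm_occ].
Qed.

Lemma occ_lin n (a : R) f h w :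
  occ n (fun x => a * f x + h x) w = a * occ n f w + occ n h w.
Proof.
rewrite /occ mulrA -mulrDl mulr_sumr -big_split/=; congr (_ / _).
by apply: eq_bigr => k _; ring.
Qed.

Lemma occ_ge0 n f w : (forall x, 0 <= f x) -> 0 <= occ n f w.
Proof.
move=> f0; rewrite divr_ge0 ?(ltW (step_sum_gt0 eta_gt0 n))//.
by apply: sumr_ge0 => k _; rewrite mulr_ge0 ?(ltW (eta_gt0 _)).
Qed.

Lemma occ1 n w : occ n (fun=> 1) w = 1.
Proof.
rewrite /occ; under eq_bigr do rewrite mulr1.
by rewrite divff// lt0r_neq0// step_sum_gt0.
Qed.

Lemma plf_occ n w : plf (occ n ^~ w).
Proof. by split=> [a f h _ _|f _]; [exact: occ_lin|exact: occ_ge0]. Qed.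

Lemma survival01 n w : 0 <= 1 - survival w n <= 1.
Proof.
rewrite subr_ge0 kop1_le/= gerBl.
exact: plf1_ge0 (plf_kop K _).
Qed.

Lemma plf_next_mean n w : plf (fun h => next_mean h n w).
Proof.
have /andP[s0 _] := survival01 n w.
split=> [a f h bf bh|f bf f0].
  by rewrite /next_mean occ_lin (plf_kop K _).1//; ring.
apply: addr_ge0; first exact: (plf_kop K (X n w)).2.
by apply: mulr_ge0 => //; exact: occ_ge0.
Qed.

Lemma next_mean1 n w : next_mean (fun=> 1) n w = 1.
Proof. by rewrite /next_mean occ1; ring. Qed.

Lemma kreturnE n w (A : set T) : measurable A ->
  kreturn K (occupation eta (fun k => X k w) n) (X n w) A =
  (next_mean \1_A n w)%:E.
Proof.
move=> mA; rewrite /kreturn killE -kop_indic// /next_mean.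
rewrite [RHS]EFinD [X in _ = (_ + X)%E]EFinM.
congr (_ + _ * _)%E; rewrite /occupation.
under eq_bigr do rewrite diracE -EFinM.
by rewrite !sumEFin inver gt_eqF ?(step_sum_gt0 eta_gt0)// -EFinM.
Qed.

(** Bounded and measurable for [F n]. Viewing [F n] as the sigma-algebra of a type of its own lets
    [plf_ext] run over events of [F n]. *)
Definition bmF n Z := bm (Z : g_sigma_algebraType (F n) -> R).

Let F_sigma n : sigma_algebra setT (F n). Proof. by case: filtF. Qed.

Let F_measurable n (B : set Omega) :
  measurable (B : set (g_sigma_algebraType (F n))) -> F n B.
Proof.
move=> mB; have : <<s F n >> B := mB.
by rewrite (sigma_algebra_id (F_sigma n)).
Qed.

Let bmF_bm n Z : bmF n Z -> bm Z.
Proof.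
move=> [mZ bZ]; split => // _ B mB.
have := mZ measurableT B mB; rewrite !setTI => h.
have [_ Fm _] := filtF; apply: (Fm n).
exact: F_measurable.
Qed.

Lemma bmF_RV m n f : (m <= n)%N -> bm f -> bmF n (fun w => f (X m w)).
Proof.
move=> mn [mf bf]; split; last by case: bf => c fc; exists c.
apply: (@measurableT_comp _ _ _ (g_sigma_algebraType (F n)) T R f) => //.
move=> _ B mB; rewrite setTI; apply: sub_sigma_algebra.
by have [_ _ /(_ m n mn)] := filtF; apply; exact: adX.
Qed.

Lemma bmF_occ m n f : (m <= n)%N -> bm f -> bmF n (occ m f).
Proof.
move=> mn bf; rewrite /bmF /occ; under [X in bm X]eq_fun do rewrite mulrC.
apply: bmZ; apply: (@bm_sum _ (g_sigma_algebraType (F n)) R _ _ _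
  (fun (k : 'I_m.+1) w => eta k * f (X k w))).
move=> k; apply: bmZ; apply: bmF_RV => //.
by rewrite (leq_trans _ mn)// -ltnS.
Qed.

Lemma bmF_next_mean m n h : (m <= n)%N -> bm h -> bmF n (next_mean h m).
Proof.
move=> mn bh; apply: bmD; first by apply: bmF_RV => //; exact: bm_kop.
apply: bmM; last exact: bmF_occ.
apply: bmB; first exact: bm_cst.
by apply: (bmF_RV mn); apply: bm_kop; exact: bm_cst.
Qed.

(** Two extensions from indicators: in [h] for a fixed event of [F n], where the indicator case is
    the definition of conditional probability, then in [Z]. *)
Lemma expect_next h n Z : bm h -> bmF n Z ->
  expect (fun w => h (X n.+1 w) * Z w) =
  expect (fun w => next_mean h n w * Z w).
Proof.
have stepB (B : set Omega) : F n B -> forall h, bm h ->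
    expect (fun w => h (X n.+1 w) * \1_B w) =
    expect (fun w => next_mean h n w * \1_B w).
  move=> FB; have mB : measurable B by have [_ + _] := filtF; apply; exact: FB.
  have bB : bm (\1_B : Omega -> R) by exact: bm_indic.
  have B0 w : 0 <= \1_B w :> R by exact: ler0n.
  apply: plf_ext.
  - apply: plf_blf; split=> [a f g bf bg|f bf f0].
      rewrite -plf_expect.1; [|by apply: bmM => //; exact: bm_RV..].
      by congr expect; apply/funext => w; ring.
    apply: plf_expect.2; first by apply: bmM => //; exact: bm_RV.
    by move=> w; rewrite mulr_ge0.
  - apply: plf_blf; split=> [a f g bf bg|f bf f0].
      rewrite -plf_expect.1; [|by apply: bmM => //; exact: bm_next_mean..].
      congr expect; apply/funext => w.
      by rewrite (plf_next_mean n w).1//; ring.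
    apply: plf_expect.2; first by apply: bmM => //; exact: bm_next_mean.
    by move=> w; rewrite mulr_ge0//; exact: (plf_next_mean n w).2.
  - move=> A mA; have [_ /(_ B FB)] := X_trans n mA.
    under eq_integral do rewrite kreturnE//.
    rewrite integral_mkcond => E.
    have -> : (fun w => \1_A (X n.+1 w) * \1_B w : R) = \1_(X n.+1 @^-1` A `&` B).
      apply/funext => w; rewrite -[LHS]/(\1_(X n.+1 @^-1` A) w * \1_B w).
      by rewrite indicI.
    rewrite /expect Rintegral_indic; last first.
      apply: measurableI => //; rewrite -[X in measurable X]setTI.
      exact: measurable_funPT.
    apply: (etrans (congr1 fine (esym E))); congr fine; apply: eq_integral => w _.
    rewrite patchE indicE; case: ifP => _; first by rewrite mulr1.
    by rewrite mulr0.
have ub (Y : Omega -> R) (c : R) Z' : (forall w, `|Y w| <= c) -> bm Y -> 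
    forall e, bmF n Z' -> (forall w, `|Z' w| <= e) ->
    `|expect (fun w => Y w * Z' w)| <= c * e.
  move=> Yc bY e bZ Ze; have := plf_norm_le plf_expect (bmM bY (bmF_bm bZ)).
  move=> /(_ (c * e)); rewrite expect1 mulr1; apply => w.
  by rewrite normrM ler_pM.
have blfY (Y : Omega -> R) : bm Y -> @blf _ (g_sigma_algebraType (F n)) R
    (fun Z => expect (fun w => Y w * Z w)).
  move=> bY; split=> [a f g bf bg|].
    rewrite -plf_expect.1;
      [|exact: (bmM bY (@bmF_bm n _ bf))|exact: (bmM bY (@bmF_bm n _ bg))].
    by congr expect; apply/funext => w; ring.
  have [c c0 Yc] := bm_ub bY; exists c => f e bf fe.
  exact: ub.
move=> bh; move: Z; apply: (@plf_ext _ (g_sigma_algebraType (F n))).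
- by apply: blfY; exact: bm_RV.
- by apply: blfY; exact: bm_next_mean.
- by move=> B mB; apply: stepB => //; exact: F_measurable.
Qed.

Lemma expect_nextE h n : bm h ->
  expect (fun w => h (X n.+1 w)) = expect (next_mean h n).
Proof.
move=> bh; have := expect_next bh (bm_cst 1 : bmF n (fun=> 1)).
under eq_fun do rewrite mulr1; under [in RHS]eq_fun do rewrite mulr1.
by [].
Qed.

(** Martingale increments; their sums weighted by [eta] form a martingale shifted by one in the
    filtration. *)
Definition innovation h n w : R := h (X n.+1 w) - next_mean h n w.

Definition innovation_sum h n w : R :=
  \sum_(k < n.+1) eta k * innovation h k w.

Let bmF_innovation h n : bm h -> bmF n.+1 (innovation h n).
Proof.
by move=> bh; apply: bmB; [exact: bmF_RV|exact: bmF_next_mean].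
Qed.

Let bmF_innovation_sum h n : bm h -> bmF n.+1 (innovation_sum h n).
Proof.
move=> bh; apply: (@bm_sum _ (g_sigma_algebraType (F n.+1)) R _ _ _
  (fun (k : 'I_n.+1) w => eta k * innovation h k w)).
move=> k; apply: bmZ; apply: bmB; first exact: bmF_RV.
by apply: bmF_next_mean => //; exact: ltnW.
Qed.

Let bm_innovation_sum h n : bm h -> bm (innovation_sum h n).
Proof. by move=> bh; exact: bmF_bm (bmF_innovation_sum n bh). Qed.

Let innovation_le h c n w : bm h -> (forall x, `|h x| <= c) ->
  `|innovation h n w| <= 2 * c.
Proof.
move=> bh hc; have := plf_norm_le (plf_next_mean n w) bh hc.
rewrite next_mean1 mulr1 => h1; rewrite (le_trans (ler_normB _ _))//.
by have := hc (X n.+1 w); lra.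
Qed.

(** Increments are orthogonal: the past sum is measurable for [F n.+1], so [expect_next] cancels the
    cross term. Each increment is at most [2 * c] in absolute value. *)
Lemma innovation_sum_var h c n : bm h -> (forall x, `|h x| <= c) ->
  expect (fun w => innovation_sum h n w ^+ 2) <=
  4 * c ^+ 2 * \sum_(k < n.+1) eta k ^+ 2.
Proof.
move=> bh hc.
have c0 : 0 <= c by exact: le_trans (hc point).
have inno2 m : expect (fun w => innovation h m w ^+ 2) <= 4 * c ^+ 2.
  rewrite -[leRHS]mulr1 -[X in _ <= _ * X]expect1 -(lin_cst plf_expect.1).
  apply: (plf_le plf_expect); [|exact: bm_cst|move=> w].
    by have bi := bmF_bm (bmF_innovation m bh); exact: bmM.
  rewrite -real_normK ?num_real// (_ : 4 * c ^+ 2 = (2 * c) ^+ 2); last by ring.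
  by rewrite lerXn2r ?nnegrE ?mulr_ge0//; exact: innovation_le.
elim: n => [|n IH].
  under eq_fun do rewrite /innovation_sum big_ord1 exprMn.
  have bi := bmF_bm (bmF_innovation 0 bh).
  rewrite big_ord1 (linZ plf_expect.1); last exact: bmM.
  by rewrite [leRHS]mulrC ler_wpM2l// sqr_ge0.
have bi := bmF_bm (bmF_innovation n.+1 bh).
have bs := bm_innovation_sum n bh.
have cross : expect (fun w => innovation h n.+1 w * innovation_sum h n w) = 0.
  have := expect_next bh (bmF_innovation_sum n bh) => /eqP.
  rewrite -subr_eq0 -(linB plf_expect.1).
  - move=> /eqP E; rewrite -[RHS]E; congr expect; apply/funext => w.
    by rewrite /innovation mulrBl.
  - by apply: bmM => //; exact: bm_RV.
  - by apply: bmM => //; exact: bm_next_mean.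
have -> : (fun w => innovation_sum h n.+1 w ^+ 2) = (fun w =>
    2 * eta n.+1 * (innovation h n.+1 w * innovation_sum h n w) +
    (innovation_sum h n w ^+ 2 + eta n.+1 ^+ 2 * innovation h n.+1 w ^+ 2)).
  apply/funext => w; rewrite {1}/innovation_sum big_ord_recr/=.
  by rewrite -/(innovation_sum h n w); ring.
have bi2 : bm (fun w => innovation h n.+1 w ^+ 2) by exact: bmM.
have bs2 : bm (fun w => innovation_sum h n w ^+ 2) by exact: bmM.
rewrite plf_expect.1 ?cross ?mulr0 ?add0r; [|exact: bmM|exact/bmD/bmZ].
rewrite (linD plf_expect.1)//; last exact: bmZ.
rewrite (linZ plf_expect.1)// big_ord_recr/= mulrDr lerD//.
by rewrite [leRHS]mulrC ler_wpM2l// sqr_ge0.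
Qed.

Hypothesis gamma_noninc : nonincreasing_seq (gamma eta).
Hypothesis gamma_sum : (\sum_(0 <= n <oo) (gamma eta n)%:E = +oo)%E.
Hypothesis gamma_0 : gamma eta n @[n --> \oo] --> 0.

(** The common size of both errors: the Abel sum is of order [rho n * S n], the variance of the
    martingale of order [rho n * S n ^+ 2]. *)
Let rho n : R := (\sum_(k < n.+1) eta k * gamma eta k) / S n.

Let rho_cvg0 : rho n @[n --> \oo] --> 0.
Proof. exact: weighted_average_cvg0. Qed.

Let rho_gt0 n : 0 < rho n.
Proof.
rewrite divr_gt0 ?step_sum_gt0// big_ord_recr/= ltr_wpDl//.
  by apply: sumr_ge0 => k _; rewrite mulr_ge0 ?gamma_ge0// ltW.
by rewrite mulr_gt0// /gamma divr_gt0// step_sum_gt0.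
Qed.

Lemma innovation_average_cvg0 h : bm h ->
  expect (fun w => `|innovation_sum h n w|) / S n @[n --> \oo] --> 0.
Proof.
move=> bh; have [c c0 hc] := bm_ub bh.
have main n : expect (fun w => `|innovation_sum h n w|) / S n <=
    (1 + 4 * c ^+ 2) * Num.sqrt (rho n).
  have s0 := step_sum_gt0 eta_gt0 n.
  have r0 : 0 < Num.sqrt (rho n) by rewrite sqrtr_gt0.
  pose e := Num.sqrt (rho n) * S n.
  have e0 : 0 < e by rewrite mulr_gt0.
  have bs := bm_innovation_sum n bh.
  have bs2 : bm (fun w => innovation_sum h n w ^+ 2) by exact: bmM.
  rewrite ler_pdivrMr//.
  apply: (@le_trans _ _ (expect (fun w => e^-1 * innovation_sum h n w ^+ 2 + e))).
    apply: (plf_le plf_expect); first exact: bm_norm.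
      exact: (bmD (bmZ _ bs2) (bm_cst e)).
    (* [|y| <= y^2 / e + e], with [e] balancing the two terms after integration. *)
    move=> w; rewrite -[X in _ <= _ * X + _]real_normK ?num_real//.
    move: (`|_|) => y; rewrite -(ler_pM2l e0) mulrDr mulVKf ?lt0r_neq0//.
    by have := sqr_ge0 (y - e / 2); rewrite sqrrB; nra.
  rewrite plf_expect.1//; last exact: bm_cst.
  rewrite (lin_cst plf_expect.1) expect1 mulr1.
  have := innovation_sum_var n bh hc.
  have /(le_trans _) := eta_sq_sum_le eta_gt0 n.
  have -> : S n * \sum_(k < n.+1) gamma eta k * eta k = e ^+ 2.
    rewrite exprMn sqr_sqrtr ?(ltW (rho_gt0 n))// /rho expr2 mulrA divfK ?lt0r_neq0//.
    by rewrite mulrC; congr (_ * _); apply: eq_bigr => k _; rewrite mulrC.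
  move=> /(_ _ (lexx _)) h1 h2.
  have {}h2 : expect (fun w => innovation_sum h n w ^+ 2) <= 4 * c ^+ 2 * e ^+ 2.
    by rewrite (le_trans h2)// ler_wpM2l// mulr_ge0 ?sqr_ge0.
  rewrite -mulrA -/e mulrDl mul1r addrC lerD2l.
  by rewrite mulrC ler_pdivrMr// -mulrA -expr2.
have h0 : (1 + 4 * c ^+ 2) * Num.sqrt (rho n) @[n --> \oo] --> 0.
  rewrite -[X in _ --> X](mulr0 (1 + 4 * c ^+ 2)); apply: cvgMr.
  rewrite -[X in _ --> X](@sqrtr0 R).
  exact: (continuous_cvg _ (@sqrt_continuous R 0) rho_cvg0).
apply: (squeeze_cvgr (f := fun=> 0) _ _ h0); last exact: cvg_cst.
apply: nearW => n; rewrite main andbT divr_ge0 ?(ltW (step_sum_gt0 eta_gt0 n))//.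
apply: plf_expect.2; first exact/bm_norm/bm_innovation_sum.
by move=> w; exact: normr_ge0.
Qed.

Variable A : (T -> R) -> T -> R.
Hypothesis bmA : forall f, bm f -> bm (A f).
Hypothesis poissonA : forall f x, bm f -> A f x = f x + kop K (A f) x.

(* Poisson equation for the kernel with return: [f = A f - K (A f)] turns the
   weighted sum of [f] along the path into a telescoping part, a martingale and
   the weighted sum of the resurrection terms. *)
Lemma occ_poisson f n w : bm f ->
  occ n f w * S n = \sum_(k < n.+1) eta k * (A f (X k w) - A f (X k.+1 w)) +
    innovation_sum (A f) n w +
    \sum_(k < n.+1) eta k * ((1 - survival w k) * occ k (A f) w).
Proof.
move=> bf; rewrite /occ divfK ?lt0r_neq0 ?step_sum_gt0// -!big_split/=.
apply: eq_bigr => k _; rewrite -/(occ k (A f) w) /innovation /next_mean.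
by rewrite [in X in _ * (X - _)](poissonA _ bf); ring.
Qed.

Lemma occ_domination f phi : bm f -> bm phi ->
  expect (fun w => Num.max 0 (`|occ n (A f) w| - occ n (A phi) w)) @[n --> \oo]
    --> 0 ->
  expect (fun w => Num.max 0 (`|occ n f w| - occ n phi w)) @[n --> \oo] --> 0.
Proof.
move=> bf bphi.
pose p f phi n w : R := Num.max 0 (`|occ n f w| - occ n phi w).
rewrite -/(p (A f) (A phi)) => DA0.
have bp g1 g2 n : bm g1 -> bm g2 -> bm (p g1 g2 n).
  by move=> b1 b2; apply/bm_max0/bmB; [apply/bm_norm|]; exact: bm_occ.
have p0 g1 g2 n w : 0 <= p g1 g2 n w by rewrite le_max lexx.
have bAf := bmA bf; have bAphi := bmA bphi.
have [c1 _ fc] := bm_ub bAf; have [c2 _ phic] := bm_ub bAphi.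
pose c := 2 * c1 + 2 * c2.
pose M g n w : R := `|innovation_sum g n w|.
have bM g n : bm g -> bm (M g n).
  by move=> bg; exact/bm_norm/bm_innovation_sum.
have S0 n := step_sum_gt0 eta_gt0 n.
have pw n w : p f phi n w <= (S n)^-1 *
    ((\sum_(k < n.+1) eta k * p (A f) (A phi) k w + c * (rho n * S n)) +
     (M (A f) n w + M (A phi) n w)).
  rewrite mulrC ler_pdivlMr//.
  have rhoS : \sum_(k < n.+1) gamma eta k * eta k = rho n * S n.
    rewrite /rho divfK ?lt0r_neq0//.
    by apply: eq_bigr => k _; rewrite mulrC.
  have := occ_poisson n w bphi; have := occ_poisson n w bf.
  have := abel_step_bound eta_gt0 gamma_noninc n (fun k => fc (X k w)).
  have := abel_step_bound eta_gt0 gamma_noninc n (fun k => phic (X k w)).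
  rewrite rhoS.
  set a2 := \sum_(k < n.+1) _; move=> ha2.
  set a1 := \sum_(k < n.+1) _; move=> ha1.
  set s1 := \sum_(k < n.+1) _; move=> E1.
  set s2 := \sum_(k < n.+1) _; move=> E2.
  set sp := \sum_(k < n.+1) _.
  have sP : `|s1| - s2 <= sp.
    rewrite /s1 /s2 /sp lerBlDr (le_trans (ler_norm_sum _ _ _))//.
    rewrite -big_split/=; apply: ler_sum => k _.
    have /andP[k0 k1] := survival01 k w.
    rewrite normrM gtr0_norm// -mulrDr ler_pM2l// normrM ger0_norm//.
    rewrite -lerBlDr -mulrBr.
    have : `|occ k (A f) w| - occ k (A phi) w <= p (A f) (A phi) k w.
      by rewrite /p le_max lexx orbT.
    by have := p0 (A f) (A phi) k w; nra.
  have sp0 : 0 <= sp by apply: sumr_ge0 => k _; rewrite mulr_ge0// ltW.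
  have r0 : 0 <= rho n * S n by rewrite mulr_ge0// ltW.
  have c1r : `|a1| <= 2 * c1 * (rho n * S n) by [].
  have c2r : `|a2| <= 2 * c2 * (rho n * S n) by [].
  have m1 : 0 <= M (A f) n w by exact: normr_ge0.
  have m2 : 0 <= M (A phi) n w by exact: normr_ge0.
  have -> : p f phi n w * S n =
      Num.max 0 (`|occ n f w * S n| - occ n phi w * S n).
    rewrite /p [`|_ * S n|]normrM (gtr0_norm (S0 n)) -mulrBl.
    by rewrite maxr_pMl ?(ltW (S0 n))// mul0r.
  rewrite ge_max; apply/andP; split.
    have := normr_ge0 a1; have := normr_ge0 a2; rewrite /c; lra.
  rewrite E1 E2.
  have t1 := ler_normD (a1 + innovation_sum (A f) n w) s1.
  have t2 := ler_normD a1 (innovation_sum (A f) n w).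
  have t3 := ler_norm (- a2).
  have t4 := ler_norm (- innovation_sum (A phi) n w).
  rewrite normrN in t3; rewrite normrN in t4.
  by rewrite /M /c; lra.
have bound n : expect (p f phi n) <=
    (\sum_(k < n.+1) eta k * expect (p (A f) (A phi) k)) / S n + c * rho n +
    (expect (M (A f) n) / S n + expect (M (A phi) n) / S n).
  have bs : bm (fun w => \sum_(k < n.+1) eta k * p (A f) (A phi) k w).
    apply: (@bm_sum _ _ _ _ _ _
      (fun (k : 'I_n.+1) w => eta k * p (A f) (A phi) k w)).
    by move=> k; exact/bmZ/bp.
  have bs1 := bmD bs (bm_cst (c * (rho n * S n))).
  have bs2 := bmD (bM _ n bAf) (bM _ n bAphi).
  have b12 := bmZ (S n)^-1 (bmD bs1 bs2).
  apply: (le_trans (plf_le plf_expect (bp _ _ n bf bphi) b12 (pw n))).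
  rewrite (linZ plf_expect.1); last exact: bmD.
  rewrite (linD plf_expect.1)// (linD plf_expect.1)//; last exact: bm_cst.
  rewrite (linD plf_expect.1); [|exact: bM..].
  rewrite (lin_sum plf_expect.1 _ _
    (F := fun (k : 'I_n.+1) w => eta k * p (A f) (A phi) k w)).
    under eq_bigr => k _ do rewrite (linZ plf_expect.1 _ (bp _ _ k bAf bAphi)).
    rewrite (lin_cst plf_expect.1) expect1 mulr1.
    rewrite le_eqVlt; apply/orP; left; apply/eqP.
    by field; rewrite lt0r_neq0.
  by move=> k; exact/bmZ/bp.
apply: (cvg_dist_le (e := fun n =>
    (\sum_(k < n.+1) eta k * expect (p (A f) (A phi) k)) / S n + c * rho n +
    (expect (M (A f) n) / S n + expect (M (A phi) n) / S n))) => [n|].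
  rewrite subr0 ger0_norm; first exact: bound.
  by apply: plf_expect.2; [exact: (bp f phi n)|exact: (p0 f phi n)].
rewrite [X in _ --> X](_ : 0 = 0 + c * 0 + (0 + 0)); last by rewrite mulr0 !addr0.
apply: cvgD; [apply: cvgD|apply: cvgD].
- exact: (weighted_average_cvg0 eta_gt0 gamma_sum DA0).
- exact: cvgMr.
- exact: innovation_average_cvg0.
- exact: innovation_average_cvg0.
Qed.

(** At level [N] the excess is identically 0, because [occ] is a positive functional. Each use of
    [occ_domination] removes one [A] from both sides, down to [g] against the constant [e / 2],
    whose average is itself. *)
Lemma occ_cvg0 g : bm g ->
  (forall (a : R) h x, bm h -> A (fun y => a * h y) x = a * A h x) ->
  (forall e : R, 0 < e -> exists N, forall x,
     `|iter N A g x| <= e * iter N A (fun=> 1) x) ->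
  expect (fun w => `|occ n g w|) @[n --> \oo] --> 0.
Proof.
move=> bg AZ small.
have bI N h : bm h -> bm (iter N A h) by move=> bh; elim: N => //= N; exact: bmA.
apply/cvgrPdist_le => e e0.
have e2 : 0 < e / 2 by rewrite divr_gt0.
have [N Ng] := small _ e2.
have down j : (j <= N)%N -> expect (fun w => Num.max 0
    (`|occ n (iter (N - j) A g) w| -
     occ n (fun x => e / 2 * iter (N - j) A (fun=> 1) x) w)) @[n --> \oo] --> 0.
  elim: j => [_|j IH jN].
    rewrite subn0 (_ : (fun n => _) = fun=> 0); first exact: cvg_cst.
    apply/funext => n; apply: (etrans _ (lin0 plf_expect.1)); congr expect.
    apply/funext => w; rewrite max_l// subr_le0.
    rewrite (le_trans (plf_norm (plf_occ n w) (bI N _ bg)))//.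
    apply: (plf_le (plf_occ n w)) => //; first exact/bm_norm/bI.
    exact/bmZ/bI/bm_cst.
  have bj : bm (iter (N - j.+1) A (fun=> 1 : R)) by exact/bI/bm_cst.
  apply: occ_domination; [exact: bI|exact: bmZ|].
  have -> : A (fun x => e / 2 * iter (N - j.+1) A (fun=> 1) x) =
      (fun x => e / 2 * iter (N - j) A (fun=> 1) x).
    apply/funext => x; rewrite AZ// -[A _ x]/(iter (N - j.+1).+1 A (fun=> 1) x).
    by rewrite subnSK.
  rewrite -iterS subnSK//; apply: IH; exact: ltnW.
have := down N (leqnn N); rewrite subnn/= => /cvgrPdist_le/(_ _ e2)[M _ MN].
exists M => // n /= /MN/=; rewrite !sub0r !normrN mulr1 => h.
have bo := bm_occ n bg.
have bm1 : bm (fun w => Num.max 0 (`|occ n g w| - occ n (fun=> e / 2) w)).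
  apply/bm_max0/bmB; [exact: bm_norm|apply: bm_occ; exact: bm_cst].
rewrite ger0_norm; last by apply: plf_expect.2; [exact: bm_norm|].
apply: (@le_trans _ _ (expect (fun w =>
    Num.max 0 (`|occ n g w| - occ n (fun=> e / 2) w) + e / 2))).
  apply: (plf_le plf_expect); [exact: bm_norm|exact: (bmD bm1 (bm_cst _))|].
  move=> w; rewrite -lerBlDr le_max.
  by rewrite (lin_cst (plf_occ n w).1) occ1 !mulr1 lexx orbT.
rewrite (linD plf_expect.1)//; last exact: bm_cst.
rewrite (lin_cst plf_expect.1) expect1 mulr1.
rewrite -lerBrDr; apply: (le_trans (le_trans (ler_norm _) h)); lra.
Qed.

(* To be applied to the space [N] of functions with vanishing integral against
   the quasi-stationary distribution. *)
Lemma expect_cvg0 (N : set (T -> R)) : (forall g, N g -> bm g) ->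
  (forall g, N g -> N (kop K g)) ->
  (forall g, N g -> expect (fun w => `|occ n g w|) @[n --> \oo] --> 0) ->
  (forall g (e : R), N g -> 0 < e ->
     exists m, forall x, `|iter m (kop K) g x| <= e) ->
  forall g, N g -> expect (fun w => g (X n w)) @[n --> \oo] --> 0.
Proof.
move=> Nbm NK occN NKm.
(* One time step replaces [g] by [kop K g] up to the relocation term, bounded by [|occ g|]. As [m]
   is fixed while [n] grows, finitely many vanishing errors add up. *)
have shift m : forall g, N g -> (expect (fun w => g (X (m + n)%N w)) -
    expect (fun w => iter m (kop K) g (X n w))) @[n --> \oo] --> 0.
  elim: m => [|m IH] g Ng.
    by under eq_fun do rewrite subrr; exact: cvg_cst.
  have bg := Nbm _ Ng; have NKg := NK _ Ng; have bKg := Nbm _ NKg.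
  have h1 := IH _ NKg.
  have h2 : expect (fun w => (1 - survival w (m + n)) * occ (m + n) g w)
      @[n --> \oo] --> 0.
    have : expect (fun w => `|occ (m + n) g w|) @[n --> \oo] --> 0.
      have := occN _ Ng.
      rewrite -(cvg_shiftn m (fun n => expect (fun w => `|occ n g w|))) /=.
      by under [X in X @ _ --> _]eq_fun do rewrite addnC.
    apply: cvg_dist_le => n; rewrite subr0.
    have bo := bm_occ (m + n) bg; have bs := bm_survival (m + n).
    have bso := bmM bs bo.
    rewrite (le_trans (plf_norm plf_expect bso))//.
    apply: (plf_le plf_expect); [exact: bm_norm|exact: bm_norm|].
    move=> w; have /andP[s0 s1] := survival01 (m + n) w.
    by rewrite normrM ger0_norm// ler_piMl.
  rewrite [X in X @ _ --> _](_ : _ = fun n =>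
    (expect (fun w => kop K g (X (m + n)%N w)) -
     expect (fun w => iter m (kop K) (kop K g) (X n w))) +
    expect (fun w => (1 - survival w (m + n)) * occ (m + n) g w)).
    by rewrite -[X in _ --> X]addr0; exact: cvgD h1 h2.
  apply/funext => n; rewrite addSn expect_nextE// /next_mean (linD plf_expect.1).
  - by rewrite iterSr; ring.
  - by apply: (@bm_RV (m + n) (kop K g)).
  - by apply: bmM; [exact: bm_survival|exact: bm_occ].
move=> g Ng; apply/cvgrPdist_le => e e0.
have e2 : 0 < e / 2 by rewrite divr_gt0.
have [m mg] := NKm _ _ Ng e2.
have /cvgrPdist_le/(_ _ e2)[M _ MP] := shift m g Ng.
exists (m + M)%N => // n /= mMn; rewrite sub0r normrN.
have mn : (m <= n)%N by rewrite (leq_trans _ mMn)// leq_addr.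
have /MP : (M <= n - m)%N by rewrite leq_subRL.
rewrite /= subnKC// sub0r normrN => h1.
have h2 : `|expect (fun w => iter m (kop K) g (X (n - m)%N w))| <= e / 2.
  rewrite -[leRHS]mulr1 -[X in _ <= _ * X]expect1.
  apply: (plf_norm_le plf_expect); last by move=> w; exact: mg.
  apply: (@bm_RV (n - m) (iter m (kop K) g)).
  by apply: bm_iter; [exact: pop_kop|exact: Nbm].
move: h1 h2; rewrite !ler_norml => /andP[a1 a2] /andP[b1 b2].
by apply/andP; split; lra.
Qed.

End process.

(** * The survival hypothesis without quotients, and the limit law *)

Lemma survival_ratio_sup d (T : measurableType d) (R : realType)
    (K : R.-spker T ~> T) (Psi : probability T R) (C : nat -> R) :
  (forall n, ((C n)%:E <= (\int[Psi]_x kiter K n x setT) /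
     ereal_sup [set kiter K n x setT | x in [set: T]])%E) ->
  forall n x, C n * iter n (kop K) (fun=> 1) x <=
    \int[Psi]_y iter n (kop K) (fun=> 1) y.
Proof.
move=> H4 n x; have := H4 n.
have Psifin : (Psi setT < +oo)%E by rewrite probability_setT ltry.
have bK : bm (iter n (kop K) (fun=> 1 : R)).
  by apply: bm_iter; [exact: pop_kop|exact: bm_cst].
have K0 y : 0 <= iter n (kop K) (fun=> 1) y.
  exact: (pop_ge0 y (pop_iter n (pop_kop K)) (bm_cst 1)).
have -> : (\int[Psi]_x kiter K n x setT =
    (\int[Psi]_y iter n (kop K) (fun=> 1) y)%R%:E)%E.
  by rewrite -EFin_Rintegral//; apply: eq_integral => y _; rewrite kiter_setT.
set s := ereal_sup _.
have s1 : (s <= 1)%E by exact: sprob_kernel.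
have : ((iter n (kop K) (fun=> 1) x)%:E <= s)%E.
  by rewrite -kiter_setT; apply: le_ereal_sup_tmp; exists (kiter K n x setT).
have Psi0 : 0 <= \int[Psi]_y iter n (kop K) (fun=> 1) y by exact: Rintegral_ge0.
(* When the supremum vanishes the quotient carries no information, but then [K^n 1] is zero and the
   claim is immediate. *)
case: s s1 => [r| |] //= _; rewrite lee_fin => xr; have [r0|r0] := leP r 0.
  have -> : iter n (kop K) (fun=> 1) x = 0.
    by apply/eqP; rewrite eq_le K0 (le_trans xr).
  by rewrite mulr0.
rewrite inver gt_eqF// -EFinM lee_fin ler_pdivlMr// => h.
have [C0|C0] := leP 0 (C n); first by rewrite (le_trans _ h)// ler_wpM2l.
by rewrite (le_trans _ Psi0)// mulr_le0_ge0// ltW.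
Qed.

Lemma Rintegral_distribution d d' (T : measurableType d)
    (Omega : measurableType d') (R : realType) (P : probability Omega R)
    (X : {RV P >-> T}) (f : T -> R) : bm f ->
  \int[distribution P X]_x f x = \int[P]_w f (X w).
Proof.
move=> bf; rewrite /Rintegral integral_distribution//.
  by apply/measurable_EFinP; case: bf.
have bfX : bm (fun w => f (X w)) by exact: bm_RV (fun=> X) 0 f bf.
have Pfin : (P setT < +oo)%E by rewrite probability_setT ltry.
exact: bm_integrable Pfin _ bfX.
Qed.

Local Open Scope ereal_scope.

Theorem theorem2p6
  (R : realType) (E : pmetricType R) (compactE : compact [set: E])
  (K : R.-spker (borel E) ~> (borel E)) (K_gt0 : submarkovian K)
  (* step sizes *)
  (eta : nat -> R) (eta_gt0 : forall n, (0 < eta n)%R)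
  (gamma_noninc : nonincreasing_seq (gamma eta))
  (gamma_sum : \sum_(0 <= n <oo) (gamma eta n)%:E = +oo)
  (gamma_ln : (gamma eta n * ln n%:R)%R @[n --> \oo] --> 0%R)
  (* H1, H2 *)
  (H1 : feller K)
  (H2 : cemetery_accessible K)
  (* H3 *)
  (U : set E) (openU : open U) (U_neq0 : U !=set0)
  (U_acc : accessible K U)
  (Psi : probability (borel E) R) (eps : R) (eps_gt0 : (0 < eps)%R)
  (U_small : weak_small K U Psi eps)
  (* H4 *)
  (C : R -> R)
  (C_ge0 : forall s, (0 <= s)%R -> (0 <= C s)%R)
  (C_noninc : {in `[0%R, +oo[ &, {homo C : s t / (s <= t)%R >-> (t <= s)%R}})
  (C_convex : @convex_function R R^o `[0%R, +oo[%classic C)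
  (C_int : \int[lebesgue_measure]_(s in `[0%R, +oo[) (C s)%:E = +oo)
  (H4 : forall n : nat, (C n%:R)%:E <=
     (\int[Psi]_x kiter K n x setT) /
     ereal_sup [set kiter K n x setT | x in [set: borel E]])
  (mustar : probability (borel E) R) (mustar_qsd : is_qsd K mustar)
  (* the process *)
  (d : measure_display) (Omega : measurableType d) (P : probability Omega R)
  (F : nat -> set (set Omega)) (filtF : filtration F)
  (X : nat -> {RV P >-> borel E}) (adX : adapted F X)
  (alpha : probability (borel E) R)
  (X0_law : forall A, measurable A -> distribution P (X 0%N) A = alpha A)
  (X_trans : forall (n : nat) (A : set (borel E)), measurable A ->
     cond_prob P (F n) (X n.+1 @^-1` A)
       (fun w => kreturn K (occupation eta (fun k => X k w) n) (X n w) A)) :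
  weak_cvg (fun n => distribution P (X n)) mustar.
Proof.
have [D [t [t0 t1 geo]]] := iter_kop_geometric compactE H1 H2.
pose Q := kop K; have pQ : pop Q := pop_kop K.
pose A := potential Q; have pA : pop A := pop_potential pQ t0 t1 geo.
have Psifin : Psi setT < +oo by rewrite probability_setT ltry.
have mufin : mustar setT < +oo by rewrite probability_setT ltry.
have pPsi := plf_Rintegral Psifin; have pmu := plf_Rintegral mufin.
have int1 (nu : probability (borel E) R) : (\int[nu]_x 1 = 1)%R.
  have nu1 : fine (nu setT) = 1%R by rewrite probability_setT.
  by rewrite Rintegral_cst// mul1r; exact: nu1.
have [c c0 minor] :=
  small_set_minorization compactE H1 t0 t1 geo openU U_acc eps_gt0 U_small.
have C_nat (m n : nat) : (m <= n)%N -> (C n%:R <= C m%:R)%R.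
  by move=> mn; apply: C_noninc; rewrite ?in_itv/= ?andbT ?ler0n// ler_nat.
have [L ratio] := survival_ratio_ge pQ t0 t1 geo pPsi
  (fun n => C_ge0 _ (ler0n R n)) C_nat (survival_ratio_sup H4).
have th0 (N : nat) : (0 <= 2^-1 * C (L.+1 * N)%:R)%R.
  by rewrite mulr_ge0// C_ge0.
have th_unbounded (H : R) : exists k : nat,
    (H <= \sum_(j < k) 2^-1 * C (L.+1 * j.*2)%:R)%R.
  (* Even indices only, as the contraction advances by two; this doubles the block length, and the
     factor 1/2 in front of [C] doubles the target. *)
  have [//|k Hk] := @sum_noninc_unbounded R C (L.+1 * 2) _ C_ge0 C_noninc
    C_int (2 * H)%R.
  exists k; rewrite -mulr_sumr mulrC ler_pdivlMr// mulrC (le_trans Hk)//.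
  by apply: ler_sum => j _; rewrite -muln2 mulnCA mulnC.
have muQ := Rintegral_qsd mustar_qsd.
(* Integrating [A f = f + Q (A f)] gives [a = m + l * a], and [b = 1 + l * b] for [f = 1].
   Eliminating [l] yields [a = b * m], so the eigenvalue of [A] is [b], the integral of [A 1]. *)
have muA f : bm f ->
    (\int[mustar]_x A f x =
     (\int[mustar]_x A (fun=> 1) x) * \int[mustar]_x f x)%R.
  have muA1 h : bm h -> (\int[mustar]_x A h x =
      \int[mustar]_x h x +
      (\int[mustar]_x Q (fun=> 1) x) * \int[mustar]_x A h x)%R.
    move=> bh; rewrite -muQ; last exact: pA.1.
    rewrite -(linD pmu.1)//; last exact/pQ.1/pA.1.
    by apply: eq_Rintegral => x _; exact: (potentialE pQ t0 t1 geo).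
  move=> bf; have := muA1 _ bf; have := muA1 _ (bm_cst 1); rewrite int1.
  move: (\int[mustar]_x A f x)%R (\int[mustar]_x A (fun=> 1) x)%R
    (\int[mustar]_x Q (fun=> 1) x)%R (\int[mustar]_x f x)%R => a b l m E1 E2.
  have E3 : (b - l * b = 1)%R by rewrite {1}E1 addrK.
  have E4 : (a - l * a = m)%R by rewrite {1}E2 addrK.
  by rewrite -E4 -[LHS]mulr1 -E3; ring.
have gamma0 := gamma_cvg0 eta_gt0 gamma_ln.
pose null (g : borel E -> R) := bm g /\ (\int[mustar]_x g x = 0)%R.
have null_cvg g : null g -> expect P (fun w => g (X n w)) @[n --> \oo] --> 0%R.
  apply: (expect_cvg0 eta_gt0 filtF X_trans).
  - by move=> h [].
  - move=> h [bh h0]; split; first exact: pQ.1.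
    by rewrite muQ// h0 mulr0.
  - move=> h [bh h0]; apply: (occ_cvg0 eta_gt0 filtF adX X_trans gamma_noninc
      gamma_sum gamma0 pA.1 _ bh).
    + by move=> f x bf; exact: (potentialE pQ t0 t1 geo).
    + by move=> a f x bf; exact: (linZ (pA.2 x).1).
    + move=> e e0; apply: (iter_ratio_cvg0 pA pPsi pmu (int1 Psi) (int1 mustar)
        _ _ c0 th0 minor muA ratio bh h0 th_unbounded e0).
        by move=> f x; exact: (potential_ge pQ t0 t1 geo).
      by move=> x; exact: (potential1_le pQ t0 t1 geo).
  - move=> h e [bh h0] e0; have [b b0 hb] := bm_ub bh.
    have : (b * D * t ^+ m)%R @[m --> \oo] --> 0%R.
      rewrite -[X in _ --> X](mulr0 (b * D)%R); apply: cvgMr.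
      by apply: cvg_expr; rewrite gtr0_norm.
    move=> /cvgrPdist_le/(_ _ e0)[m _ /(_ m (leqnn m))].
    rewrite /= sub0r normrN => mP; exists m => x.
    rewrite (le_trans (iter_norm_le pQ geo m x bh hb))// mulrA.
    by rewrite (le_trans (ler_norm _)).
move=> f cf _; have bf : bm (f : borel E -> R) := continuous_bm compactE cf.
(* Centring puts any continuous [f] in the null space of [mustar]. *)
pose m : R := (\int[mustar]_x f x)%R.
have bg : bm (fun x : borel E => f x - m)%R by exact: bmB bf (bm_cst m).
have /null_cvg : null (fun x => f x - m)%R.
  split=> //; rewrite (linB pmu.1)//; last exact: bm_cst.
  by rewrite (lin_cst pmu.1) int1 mulr1 subrr.
move=> h; apply/subr_cvg0; move: h; apply: cvg_trans; apply: near_eq_cvg.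
apply: nearW => n /=; rewrite Rintegral_distribution//.
have Pfin : P setT < +oo by rewrite probability_setT ltry.
have P1 : fine (P setT) = 1%R by rewrite probability_setT.
rewrite /expect (linB (plf_Rintegral Pfin).1).
- by congr (_ - _)%R; rewrite Rintegral_cst// [fine _]P1 mulr1.
- exact: bm_RV X n f bf.
- exact: bm_cst.
Qed.
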